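(* Let $\alpha\ge 1$ and let $q_0=(x_0,y_0)$ and $q$ be two distinct points of the $\alpha$-Grushin plane $\mathbb{G}_\alpha$ such that $q\notin\mathrm{Cut}(q_0)$. Let $u_0\,dx|_{q_0}+v_0\,dy|_{q_0}$ be the initial covector of the unique constant speed minimising geodesic $[0,1]\to\mathbb{G}_\alpha$ joining $q_0$ to $q$. If $v_0=0$ (that is, $q_0$ and $q$ lie on the same horizontal line), then for all $t\in[0,1]$ \[ \beta_t(q_0,q)=t\,\frac{(u_0t+x_0)^{2\alpha}(u_0t+x_0)-x_0^{2\alpha}x_0}{(u_0+x_0)^{2\alpha}(u_0+x_0)-x_0^{2\alpha}x_0}. \]
   Context: Convention: for real $a$, $a^{2\alpha}$ means $(a^2)^\alpha=|a|^{2\alpha}$ (and similarly for $a^{2(\alpha-1)}$). The $\alpha$-Grushin plane $\mathbb{G}_\alpha$ ($\alpha\ge1$) is $\mathbb{R}^2$ with the sub-Riemannian structure generated by the vector fields $X=\partial_x$ and $Y_\alpha=|x|^\alpha\partial_y$. A curve $\gamma=(x,y):[0,T]\to\mathbb{R}^2$ is horizontal if it is Lipschitz and there are $L^2$ functions $a,b$ with $\dot\gamma=aX(\gamma)+bY_\alpha(\gamma)$ almost everywhere; its length is $\int_0^T\|\dot\gamma\|\,dt$, where $\|w\|$ is the minimum of $\sqrt{a^2+b^2}$ over all $(a,b)$ with $w=aX+bY_\alpha$ at the point. The distance $\mathrm{d}_\alpha$ between two points is the infimum of lengths of horizontal curves joining them. $\mathbb{G}_\alpha$ is equipped with $\mathrm{d}_\alpha$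 and the Lebesgue measure $\mathcal{L}^2$. A curve is minimising if its length equals the distance between its endpoints. The Hamiltonian is $H(x,y,u,v)=\frac12(u^2+v^2x^{2\alpha})$ on $T^*\mathbb{R}^2$. A normal extremal is a solution of Hamilton's equations $\dot x=u$, $\dot y=v\,x^{2\alpha}$, $\dot u=-\alpha v^2x^{2(\alpha-1)}x$, $\dot v=0$. Its projection $(x(t),y(t))$ is called a geodesic (it has constant speed $\sqrt{2H}$), the extremal is its cotangent lift, and $(u(0),v(0))$ its initial covector. Every constant speed minimising curve is a geodesic in this sense. For a geodesic $\gamma:[0,\infty)\to\mathbb{G}_\alpha$ the cut time is $t_{\mathrm{cut}}[\gamma]=\sup\{t>0:\gamma|_{[0,t]}\text{ is minimising}\}$; if it is finite, $\gamma(t_{\mathrm{cut}}[\gamma])$ is the cut point of $\gamma(0)$ along $\gamma$. $\mathrm{Cut}(q_0)$ is the set of all cut points of geodesics starting at $q_0$. Distortion coefficient: for $p,p'\in\mathbb{G}_\alpha$ and $t\in[0,1]$, \[\beta_t(p,p')=\limsup_{r\to0^+}\frac{\mathcal{L}^2(Z_t(p,B_r(p')))}{\mathcal{L}^2(B_r(p'))},\] where $B_r(p')$ is the $\mathrm{d}_\alpha$-ball and $Z_t(p,B)$ is the set of points $\gamma(t)$ for $\gamma:[0,1]\to\mathbb{G}_\alpha$ a constant speed minimising geodesic with $\gamma(0)=p$, $\gamma(1)\in B$ (outer measure is used if the set is not measurable). *)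

(* Defs.v *)
From HB Require Import structures.
From mathcomp Require Import all_boot all_order all_algebra.
From mathcomp Require Import all_classical all_reals all_analysis.
Import Order.TTheory GRing.Theory Num.Theory.
Import numFieldNormedType.Exports.

Set Implicit Arguments.
Unset Strict Implicit.
Unset Printing Implicit Defensive.

Local Open Scope classical_set_scope.
Local Open Scope ring_scope.

Section Grushin.
Context {R : realType}.
Implicit Types (a : R) (p q : R * R) (g l : R -> R * R).

(* [dblpow x s] stands for x^{2s}, read as (x^2)^s for every real x. It is 1
   for x = 0 and s = 0, and 0 for x = 0 and s > 0. *)
Definition dblpow (x s : R) : R := (x ^+ 2) `^ s.

Definition vfX (p : R * R) : R * R := (1, 0).
Definition vfY a (p : R * R) : R * R := (0, `|p.1| `^ a).

(* +oo when [w] is not a combination of the two fields at [p]; otherwise the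
   infimum is a minimum. *)
Definition sr_norm a p (w : R * R) : \bar R :=
  ereal_inf [set (Num.sqrt (c.1 ^+ 2 + c.2 ^+ 2))%:E |
             c in [set c : R * R | w = c.1 *: vfX p + c.2 *: vfY a p]].

(* Curves are functions on the whole line, of which only the restriction to
   the stated interval matters. *)
Definition L2_on (T : R) (f : R -> R) : Prop :=
  measurable_fun `[0, T] f /\
  (\int[lebesgue_measure]_(t in `[0%R, T]) ((f t) ^+ 2)%:E < +oo)%E.

Definition horizontal a (T : R) g : Prop :=
  [lipschitz g t | t in `[0, T]] /\
  exists c d : R -> R, [/\ L2_on T c, L2_on T d &
    {ae lebesgue_measure, forall t : R, t \in `[0, T] ->
       is_derive t 1 g (c t *: vfX (g t) + d t *: vfY a (g t))}].

Definition sr_length a (T : R) g : \bar R :=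
  (\int[lebesgue_measure]_(t in `[0%R, T]) sr_norm a (g t) (derive1 g t))%E.

Definition sr_dist a p q : \bar R :=
  ereal_inf [set s | exists T g,
    [/\ 0 < T, horizontal a T g, g 0 = p, g T = q & s = sr_length a T g]].

Definition sr_ball a p (r : R) : set (R * R) :=
  [set q | (sr_dist a p q < r%:E)%E].

Definition minimising a (T : R) g : Prop :=
  horizontal a T g /\ sr_length a T g = sr_dist a (g 0) (g T).

(* Derivative relative to [D]: one-sided at the endpoints of an interval. *)
Definition is_derive_in (D : set R) (f : R -> R) (t df : R) : Prop :=
  (s - t)^-1 * (f s - f t) @[s --> within D t^'] --> df.

(* Hamilton's equations for H = (u^2 + v^2 x^{2a}) / 2, where [g = (x, y)] and
   the covector is [l = (u, v)]. *)
Definition normal_extremal a (D : set R) g l : Prop :=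
  forall t, D t ->
    let x := (g t).1 in let u := (l t).1 in let v := (l t).2 in
    [/\ is_derive_in D (fun s => (g s).1) t u,
        is_derive_in D (fun s => (g s).2) t (v * dblpow x a),
        is_derive_in D (fun s => (l s).1) t
          (- (a * v ^+ 2 * dblpow x (a - 1) * x)) &
        is_derive_in D (fun s => (l s).2) t 0].

(* Geodesics have constant speed, H being preserved along extremals. *)
Definition geodesic a (D : set R) g : Prop :=
  exists l, normal_extremal a D g l.

Definition cut_time a g : \bar R :=
  ereal_sup [set t%:E | t in [set t : R | 0 < t /\ minimising a t g]].

Definition Cut a p : set (R * R) :=
  [set q | exists g (t : R), [/\ geodesic a `[0, +oo[ g, g 0 = p,
                               cut_time a g = t%:E & q = g t]].

(* The set Z_t(p, B). *)
Definition intermediate a (t : R) p (B : set (R * R)) : set (R * R) :=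
  [set z | exists g, [/\ geodesic a `[0, 1] g, minimising a 1 g,
                       g 0 = p, B (g 1) & z = g t]].

(* Outer Lebesgue measure of the plane: it is Lebesgue measure on every
   Lebesgue measurable set and is defined on all sets. *)
Definition leb2 : set (R * R) -> \bar R :=
  (mu_ext (lebesgue_measure \x lebesgue_measure)%E).

Definition distortion a (t : R) p q : \bar R :=
  limf_esup (fun r : R =>
    (leb2 (intermediate a t p (sr_ball a q r)) / leb2 (sr_ball a q r))%E)
    (0%R)^'+.

End Grushin.

(* Main.v *)
(** The geodesics issued from [(x0, y0)] with covector close to [(u0, 0)] are
    given by quadratures: with [w = v / speed] and [n = sqrt (1 - w^2 x^(2 al))],
    the abscissa satisfies [x' = speed * n], hence arc length is the primitive
    [A] of [1 / n] and the height [y - y0] is the primitive [B] of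
    [w x^(2 al) / n], both in the variable [x].

    Such an arc is minimising because [S(x, y) = w y + F(x)], with [F' = n], is
    a solution of the eikonal equation on a strip that no shorter competitor can
    leave, and [A = w B + F]. Equality in the calibration along a second
    minimising geodesic forces it to solve the same first-order equation, so the
    arc is the only minimising geodesic between its endpoints.

    In the coordinates [(X, w)], [X] being the abscissa of the endpoint, the
    ball around [q] is therefore the image of a set [W] under
    [(X, w) |-> (X, y0 + B X)], and the set of intermediate points is the image
    of [W] under [(X, w) |-> (xi, w)], where [A xi = t A X], followed by
    [(xi, w) |-> (xi, y0 + B xi)]. Each of these maps moves one coordinate only,
    with slopes close to [int_{x0}^{x1} x^(2 al)], [t] and
    [int_{x0}^{xt} x^(2 al)] respectively, so by Fubini the areas are multiplied
    by almost these constants, and the quotient tends to the stated value. *)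
Require Import Defs.
From HB Require Import structures.
From mathcomp Require Import all_boot all_order all_algebra.
From mathcomp Require Import all_classical all_reals all_analysis.
From mathcomp Require Import measurable_realfun ring lra.
Import Order.TTheory GRing.Theory Num.Theory.
Import numFieldNormedType.Exports.
Local Open Scope classical_set_scope.
Local Open Scope ring_scope.

(** * Primitives and the fundamental theorem for Lipschitz functions *)

(** Neither the balls nor the sets of intermediate points are known to be measurable, so their areas
    are outer measures and no Jacobian is computed. What passes to outer measures is a bound for a
    bijection of the whole plane that preserves one coordinate and has controlled slopes in the
    other: it transports covers to covers. This is why every map, defined at first near the segment
    only, is extended to the plane by clamping. The width [w] is a good coordinate even when the
    segment crosses the singular line [x = 0]: at fixed [X] the derivative of the height in [w] is
    the integral of [x^(2 al) / n^3] from [x0] to [X], nonzero as soon as [X] differs from [x0]. All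
    errors are multiplicative. A single bound [k] on [1 / n], close to 1 when the widths are small,
    controls every slope, and six factors of this kind must fit into an arbitrary [K > 1]. *)

Lemma continuous_primitive_from {R : realType} (k : R -> R) (c : R) :
  continuous k ->
  exists K : R -> R, forall x : R, c < x -> is_derive x 1 K (k x).
Proof.
move=> ck.
exists (fun x => (\int[lebesgue_measure]_(t in `[c, x]) k t)%R) => x cx.
have xu : x < x + 1 by rewrite ltrDl.
have int : lebesgue_measure.-integrable `[c, x + 1] (EFin \o k).
  apply: continuous_compact_integrable; first exact: segment_compact.
  exact: continuous_subspaceT.
have [d <-] := continuous_FTC1_closed xu int cx (ck x).
by rewrite derive1E; exact: derivableP.
Qed.

Lemma is_derive1_continuous {R : realType} (f : R -> R) (x d : R) :
  is_derive x 1 f d -> {for x, continuous f}.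
Proof. by move=> [dfx _]; exact/differentiable_continuous/derivable1_diffP. Qed.

Lemma eq_derive_cst {R : realType} (f g d : R -> R) (a x y : R) :
  (forall z : R, a < z -> is_derive z 1 f (d z)) ->
  (forall z : R, a < z -> is_derive z 1 g (d z)) ->
  a < x -> a < y -> f x - g x = f y - g y.
Proof.
move=> df dg; wlog xy : x y / x <= y.
  by move=> H ax ay; case: (leP x y) => [|/ltW] xy; [|symmetry]; exact: H.
move=> ax ay.
have dfg z : a < z -> is_derive z 1 (f - g) 0.
  by move=> az; rewrite -(subrr (d z)); apply: is_deriveB; [exact: df|exact: dg].
have [||z _] := @MVT_segment R (f - g) (cst 0) x y xy.
- by move=> z; rewrite in_itv/= => /andP[xz _]; apply: dfg; exact: lt_trans xz.
- apply: continuous_in_subspaceT => z; rewrite inE/= in_itv/= => /andP[xz _].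
  by apply: is_derive1_continuous (dfg z _); exact: lt_le_trans xz.
by rewrite /cst mul0r => /eqP; rewrite subr_eq0 => /eqP.
Qed.

(** Primitives on the half-lines []-n, +oo[] are glued: on an overlap two of them differ by a
    constant, so they agree once normalised at [c]. *)
Lemma continuous_primitive {R : realType} (k : R -> R) (c : R) :
  continuous k ->
  exists K : R -> R, K c = 0 /\ forall x : R, is_derive x 1 K (k x).
Proof.
move=> ck.
have [G HG] := choice (fun n : nat => continuous_primitive_from _ (- n%:R) ck).
pose N (x : R) := (Num.truncn (`|x| + `|c|)).+1.
have Nx (x : R) m : (N x <= m)%N -> - m%:R < x /\ - m%:R < c.
  move=> Nm; have : `|x| + `|c| < m%:R.
    by apply: lt_le_trans (truncnS_gt _) _; rewrite ler_nat.
  by have := ler_norm (- x); have := ler_norm (- c); rewrite !normrN;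
    have := normr_ge0 x; have := normr_ge0 c; split; lra.
pose K (x : R) := G (N x) x - G (N x) c.
have KE (x : R) m : (N x <= m)%N -> K x = G m x - G m c.
  move=> Nm; have [h1 h2] := Nx x (N x) (leqnn _); have [h3 h4] := Nx x m Nm.
  have : G (N x) x - G m x = G (N x) c - G m c.
    apply: (@eq_derive_cst _ _ _ k (- (N x)%:R)) => // z Nz; apply: HG => //.
    by apply: le_lt_trans Nz; rewrite lerN2 ler_nat.
  rewrite /K; lra.
exists K; split; first by rewrite /K subrr.
(* One more than [N x], so that the index also serves every [z] at distance less than 1 from [x]. *)
move=> x; set m := (N x).+1.
have [h1 h2] := Nx x m (leqnSn _).
have : is_derive x 1 (G m - cst (G m c)) (k x).
  by rewrite -[X in is_derive _ _ _ X]subr0; apply: is_deriveB; exact: HG.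
apply: near_eq_is_derive; near=> z; rewrite (KE z m)//.
rewrite /m /N ltnS Num.Theory.truncn_le_nat.
have : `|z - x| < 1.
  by rewrite distrC; near: z; exact: (@nbhsx_ballx _ _ x 1 ltr01).
have := Num.Theory.truncnS_gt (`|x| + `|c|); rewrite -[in X in _ -> _ -> _ < X]natr1.
have : `|z| <= `|z - x| + `|x| by rewrite -{1}(subrK x z) ler_normD.
lra.
Unshelve. all: by end_near. Qed.

(** A nonnegative integral is a supremum over simple functions, hence monotone without
    measurability; the speed of an arbitrary horizontal curve is integrated in this way. *)
Lemma ge0_le_integral_all d (T : measurableType d) (R : realType)
    (mu : {measure set T -> \bar R}) (D : set T) (f g : T -> \bar R) :
  (forall x, D x -> (0 <= f x)%E) -> (forall x, D x -> (f x <= g x)%E) ->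
  (\int[mu]_(x in D) f x <= \int[mu]_(x in D) g x)%E.
Proof.
move=> f0 fg; have g0 x : D x -> (0 <= g x)%E.
  by move=> Dx; exact: le_trans (f0 _ Dx) (fg _ Dx).
rewrite !ge0_integralE//; apply: ge_ereal_sup => _ [h hf <-].
apply: ereal_sup_ubound; exists h => // x.
by apply: le_trans (hf x) _; apply: lee_restrict.
Qed.

(** A 1-Lipschitz retraction onto [[a, b]]: composition with it extends a function from the segment
    to the line and keeps its Lipschitz constant. *)
Definition clamp {R : realType} (a b x : R) : R := Num.max a (Num.min x b).

Lemma clamp_itv {R : realType} (a b x : R) : a <= b -> a <= clamp a b x <= b.
Proof. by move=> ab; rewrite /clamp le_max lexx /= ge_max ab ge_min lexx orbT. Qed.

Lemma clamp_id {R : realType} (a b x : R) : a <= x <= b -> clamp a b x = x.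
Proof. by move=> /andP[ax xb]; rewrite /clamp min_l// max_r. Qed.

Lemma clamp_lipschitz {R : realType} (a b x y : R) :
  `|clamp a b x - clamp a b y| <= `|x - y|.
Proof.
wlog xy : x y / x <= y => [H|].
  by case: (leP x y) => [|/ltW] xy; [|rewrite distrC (distrC x)]; exact: H.
rewrite /clamp /Num.max /Num.min.
rewrite [leLHS]distrC [leRHS]distrC [leRHS]ger0_norm ?subr_ge0//.
have [xb|bx] := ltP x b; have [yb|yb] := ltP y b.
- have [ax|xa] := ltP a x; have [ay|ya] := ltP a y; rewrite ?subrr ?normr0 ?ger0_norm ?subr_ge0; lra.
- have [ax|xa] := ltP a x; have [ay|ya] := ltP a b; rewrite ?subrr ?normr0 ?ger0_norm ?subr_ge0; lra.
- lra.
- by rewrite subrr normr0 subr_ge0.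
Qed.

Lemma clamp_mono {R : realType} (a b x y : R) : x <= y ->
  0 <= clamp a b y - clamp a b x <= y - x.
Proof.
move=> xy; have := clamp_lipschitz a b y x; rewrite (ger0_norm (_ : 0 <= y - x)) ?subr_ge0//.
have h : clamp a b x <= clamp a b y.
  rewrite /clamp ge_max !le_max lexx/=; apply/orP; right.
  by rewrite le_min !ge_min xy lexx orbT.
by rewrite ger0_norm ?subr_ge0// h => ->.
Qed.

Lemma lipschitz_at_continuous {R : realType} (g : R -> R) (x C : R) :
  (forall y, `|g x - g y| <= C * `|x - y|) -> {for x, continuous g}.
Proof.
move=> gC; have C0 : 0 <= C.
  have := gC (x + 1); rewrite opprD addrA subrr sub0r normrN normr1 mulr1.
  exact: le_trans.
apply/cvgrPdist_le => /= e e0; near=> z; apply: (le_trans (gC _)).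
have : `|x - z| < e / (C + 1).
  by near: z; exists (e / (C + 1)) => //=; apply: divr_gt0 => //; lra.
rewrite ltr_pdivlMr; last lra.
by have := normr_ge0 (x - z); nra.
Unshelve. all: by end_near. Qed.

Lemma lipschitz_continuous {R : realType} (f : R -> R) (L : R) :
  (forall x y, `|f x - f y| <= L * `|x - y|) -> continuous f.
Proof. by move=> fL x; exact: lipschitz_at_continuous (fL x). Qed.

Lemma cvg_harmonic_quotient {R : realType} (f : R -> R) (x d : R) :
  is_derive x 1 f d ->
  (n.+1%:R * (f (x + n.+1%:R^-1) - f x)) @[n --> \oo] --> d.
Proof.
move=> [dfx <-].
have h0 : (fun n : nat => n.+1%:R^-1 : R) @ \oo --> (0 : R)^'.
  move=> A [e /= e0 HA]; suff : \forall n \near \oo, A (n.+1%:R^-1) by [].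
  near=> n; apply: HA => /=.
    rewrite sub0r normrN ger0_norm ?invr_ge0 ?ler0n//.
    by near: n; exact: (near_infty_natSinv_lt (PosNum e0)).
  by rewrite invr_eq0 pnatr_eq0.
have := cvg_comp _ _ h0 dfx; apply: cvg_trans; apply: near_eq_cvg.
near=> n => /=; rewrite invrK /GRing.scale/= mulr1; congr (_ * (f _ - _)).
by rewrite addrC.
Unshelve. all: by end_near. Qed.

Lemma integral_difference_quotient {R : realType} (f F : R -> R) (T h : R) :
  0 < T -> continuous f -> (forall x : R, is_derive x 1 F (f x)) ->
  (\int[lebesgue_measure]_(t in `[0%R, T]) (f (t + h) - f t)%:E =
   ((F (T + h) - F T) - (F (0 + h) - F 0))%:E)%E.
Proof.
move=> T0 cf dF.
have ch : continuous (fun t : R => t + h).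
  by move=> x; apply: continuousD; [exact: id|exact: cst_continuous].
have dFh (x : R) : is_derive x 1 (fun t => F (t + h) - F t) (f (x + h) - f x).
  apply: is_deriveB => //.
  rewrite -[X in is_derive _ _ _ X]mulr1.
  apply: (@is_derive1_comp _ F (fun t => t + h) x) => //.
  by rewrite -[X in is_derive _ _ _ X]addr0; apply: is_deriveD.
have cG : continuous (fun t => F (t + h) - F t).
  by move=> x; exact: is_derive1_continuous (dFh x).
rewrite (@continuous_FTC2 _ _ (fun t => F (t + h) - F t))//.
- apply: continuous_subspaceT => x; apply: continuousB; last exact: cf.
  by apply: continuous_comp; [exact: ch|exact: cf].
- split.
  + by move=> x _; have [] := dFh x.
  + exact: cvg_at_right_filter (cG 0).
  + exact: cvg_at_left_filter (cG T).
- by move=> x _; rewrite derive1E; have [_ ->] := dFh x.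
Qed.

(* [e] need not be measurable: its integral is a supremum over the simple
   functions below it. *)
Lemma lipschitz_le_integral {R : realType} (f : R -> R) (e : R -> \bar R) (L T : R) :
  0 < T ->
  (forall x y, 0 <= x <= T -> 0 <= y <= T -> `|f x - f y| <= L * `|x - y|) ->
  (forall t, (0 <= e t)%E) ->
  {ae lebesgue_measure, forall t : R, t \in `[0, T] ->
     exists2 d, is_derive t 1 f d & (d%:E <= e t)%E} ->
  ((f T - f 0)%:E <= \int[lebesgue_measure]_(t in `[0%R, T]) e t)%E.
Proof.
move=> T0 fL e0 [N [mN N0 NP]].
(* The bound on [f] holds on [[0, T]] only; the extension lets difference quotients step past
   [T]. *)
pose g t := f (clamp 0 T t).
have ctT t : 0 <= clamp 0 T t <= T by apply: clamp_itv; exact: ltW.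
have L0 : 0 <= L.
  have := fL T 0; rewrite subr0 !lexx (ltW T0) (gtr0_norm T0) => /(_ isT isT).
  by move/(le_trans (normr_ge0 _)); rewrite pmulr_lge0.
have gL x y : `|g x - g y| <= L * `|x - y|.
  by apply: le_trans (fL _ _ _ _) _ => //; apply: ler_wpM2l => //; exact: clamp_lipschitz.
have cg : continuous g by exact: lipschitz_continuous gL.
have [F [_ dF]] := continuous_primitive g 0 cg.
pose h (n : nat) : R := n.+1%:R^-1.
pose phi n t := n.+1%:R * (g (t + h n) - g t).
have cphi n : continuous (phi n).
  move=> x; apply: (@cvgM _ R); first exact: cvg_cst.
  apply: cvgB; last exact: cg.
  apply: continuous_comp; last exact: cg.
  by apply: continuousD; [exact: id|exact: cst_continuous].
have phiL n t : `|phi n t| <= L.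
  rewrite /phi normrM (ger0_norm (ler0n _ _)).
  have : `|g (t + h n) - g t| <= L * h n.
    by apply: le_trans (gL _ _) _; rewrite addrAC subrr add0r ger0_norm ?invr_ge0.
  rewrite -(ler_pM2l (ltr0Sn R n)) => /le_trans; apply.
  by rewrite mulrCA /h mulfV ?pnatr_eq0// mulr1.
(* The endpoints join the null set, since the extension need not be differentiable there. *)
pose N1 := N `|` [set 0; T].
have mN1 : measurable N1 by apply: measurableU => //; exact: measurableU.
have N10 : lebesgue_measure N1 = 0%E.
  rewrite null_set_setU//; first exact: measurableU.
  by rewrite null_set_setU//; exact: lebesgue_measure_set1.
have P t : 0 <= t <= T -> ~ N1 t -> exists d, [/\ is_derive t 1 g d, (d%:E <= e t)%E &
    phi n t @[n --> \oo] --> d].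
  move=> tT nN1.
  have [d df de] : exists2 d, is_derive t 1 f d & (d%:E <= e t)%E.
    apply: contrapT => H; apply: nN1; left; apply: NP => /=.
    by move=> /(_ _)/H; apply; rewrite in_itv.
  have [t0 tT1] : 0 < t /\ t < T.
    move: tT; rewrite !le_eqVlt => /andP[/orP[/eqP t0|t0]] /orP[/eqP t1|t1]//.
    - by exfalso; apply: nN1; right; left.
    - by exfalso; apply: nN1; right; left.
    - by exfalso; apply: nN1; right; right.
  have dg : is_derive t 1 g d.
    apply: near_eq_is_derive df; near=> z; rewrite /g clamp_id//.
    apply/andP; split; near: z.
      by move/lt_nbhsr: t0; apply: filterS => z /ltW.
    by move/lt_nbhsl: tT1; apply: filterS => z /ltW.
  by exists d; split => //; exact: cvg_harmonic_quotient.
pose psi n := phi n \_ (~` N1).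
pose G t := if t \in N1 then 0 else 'D_1 g t.
have psiG t : 0 <= t <= T -> psi n t @[n --> \oo] --> G t.
  move=> tT; rewrite /psi /G /patch in_setC; case: ifPn => /=.
    by move=> _; exact: cvg_cst.
  by rewrite notin_setE => /(P t tT)[d [[_ ->] _]].
have mphi n (D : set R) : measurable D -> measurable_fun D (phi n).
  by move=> mD; apply: subspace_continuous_measurable_fun => //; exact: continuous_subspaceT.
have mG : measurable_fun `[0, T] G.
  apply: (@measurable_fun_cvg _ _ _ _ psi).
    move=> n; apply: measurable_funTS; have mC := measurableC mN1.
    by apply: (measurable_restrictT _ mC).1; exact: mphi.
  by move=> t /=; rewrite in_itv/= => /psiG.
have mT : measurable (`[0, T]%classic : set R) by [].
have [|||||_ _ cvgG] := @dominated_convergence _ _ _ lebesgue_measure _ mT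
    (fun n t => (phi n t)%:E) (EFin \o G) (cst L%:E).
- by move=> n; apply/measurable_EFinP; exact: mphi.
- exact/measurable_EFinP.
- exists N1; split => // t /= H; apply: contrapT => nN1; apply: H.
  rewrite in_itv/= => tT; have [d [[_ <-] _ H]] := P t tT nN1.
  by rewrite /G memNset//; apply: cvg_EFin => //; near=> n.
- apply: (@continuous_compact_integrable _ (cst L)); first exact: segment_compact.
  by apply: continuous_subspaceT => x; exact: cst_continuous.
- by apply: aeW => t n _; rewrite lee_fin.
(* The integral of a difference quotient is a difference of quotients of the primitive [F] at [T]
   and at 0, and tends to [g T - g 0]; dominated convergence identifies this limit with the integral
   of the derivative. *)
have phiI n : (\int[lebesgue_measure]_(t in `[0%R, T]) (phi n t)%:E)%E =
    (n.+1%:R * (F (T + h n) - F T) - n.+1%:R * (F (0 + h n) - F 0))%:E.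
  rewrite -mulrBr EFinM -(integral_difference_quotient _ _ _ _ T0 cg dF).
  have int : lebesgue_measure.-integrable `[0, T] (EFin \o (fun t => g (t + h n) - g t)).
    apply: continuous_compact_integrable; first exact: segment_compact.
    apply: continuous_subspaceT => x; apply: cvgB; last exact: cg.
    apply: continuous_comp; last exact: cg.
    by apply: continuousD; [exact: id|exact: cst_continuous].
  by rewrite -(integralZl _ int).
have lim : (\int[lebesgue_measure]_(t in `[0%R, T]) (phi n t)%:E)%E @[n --> \oo]
    --> (g T - g 0)%:E.
  rewrite (_ : (fun n => _) = EFin \o (fun n : nat =>
    n.+1%:R * (F (T + h n) - F T) - n.+1%:R * (F (0 + h n) - F 0))).
    apply: cvg_EFin; first by near=> n.
    by apply: cvgB; exact: cvg_harmonic_quotient.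
  by apply/funext => n; rewrite phiI.
have -> : f T - f 0 = g T - g 0 by rewrite /g !clamp_id ?lexx ?ltW.
rewrite (cvg_unique (@ereal_hausdorff R) lim cvgG).
rewrite integralE; apply: (@le_trans _ _ (\int[lebesgue_measure]_(t in `[0%R, T]) ((EFin \o G)^\+ t))%E).
  by rewrite -[leRHS]sube0; apply: leeB => //; exact: integral_ge0.
apply: ge0_le_integral_all => // t; rewrite /= in_itv/= => tT.
rewrite funeposE/= ge_max e0 andbT /G; case: ifPn => //.
by rewrite notin_setE => /(P t tT)[d [[_ ->] ]].
Unshelve. all: by end_near. Qed.

(** * Calibrations *)

Lemma dot_le_sqrt {R : realType} (p q c d : R) :
  p ^+ 2 + q ^+ 2 <= 1 -> p * c + q * d <= Num.sqrt (c ^+ 2 + d ^+ 2).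
Proof.
move=> pq; apply: le_trans (ler_norm _) _; rewrite -sqrtr_sqr ler_wsqrtr//.
have h := sqr_ge0 (p * d - q * c).
have h1 : (c ^+ 2 + d ^+ 2) * (p ^+ 2 + q ^+ 2) <= c ^+ 2 + d ^+ 2.
  by rewrite ler_piMr// addr_ge0// sqr_ge0.
by apply: le_trans h1; lra.
Qed.

Lemma sr_norm_ge0 {R : realType} (a : R) p v : (0 <= sr_norm a p v)%E.
Proof. by apply: le_ereal_inf_tmp => _ [c _ <-]; rewrite lee_fin sqrtr_ge0. Qed.

Lemma prod_norm_le {R : realType} (p : R * R) : `|p.1| <= `|p| /\ `|p.2| <= `|p|.
Proof. by rewrite prod_normE; split; rewrite le_max lexx ?orbT. Qed.

Lemma is_derive_pairP {R : realType} (g : R -> R * R) (t : R) (v : R * R) :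
  is_derive t 1 g v <->
  is_derive t 1 (fun s => (g s).1) v.1 /\ is_derive t 1 (fun s => (g s).2) v.2.
Proof.
split=> [[/cvgrPdist_lt dg vE]|[[d1 v1] [d2 v2]]].
  have cv1 : h^-1 *: ((g (h%:A + t)).1 - (g t).1) @[h --> (0 : R)^'] --> v.1.
    rewrite -vE; apply/cvgrPdist_lt => e /dg; apply: filterS => h; apply: le_lt_trans.
    exact: (prod_norm_le ('D_1 g t - h^-1 *: (g (h%:A + t) - g t))).1.
  have cv2 : h^-1 *: ((g (h%:A + t)).2 - (g t).2) @[h --> (0 : R)^'] --> v.2.
    rewrite -vE; apply/cvgrPdist_lt => e /dg; apply: filterS => h; apply: le_lt_trans.
    exact: (prod_norm_le ('D_1 g t - h^-1 *: (g (h%:A + t) - g t))).2.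
  by split; (apply: DeriveDef; [apply/cvg_ex; eexists; eassumption|exact/cvg_lim]).
have cv : h^-1 *: (g (h%:A + t) - g t) @[h --> (0 : R)^'] --> v.
  rewrite (surjective_pairing v) -v1 -v2.
  exact: (cvg_pair d1 d2).
by apply: DeriveDef; [apply/cvg_ex; exists v|exact/cvg_lim].
Qed.

Lemma lipschitz_itvP {R : realType} (g : R -> R * R) (T : R) :
  [lipschitz g t | t in `[0, T]] ->
  exists2 L, 0 < L & forall x y, 0 <= x <= T -> 0 <= y <= T -> `|g x - g y| <= L * `|x - y|.
Proof.
move=> /pinfty_ex_gt0[L L0 H]; exists L => // x y xT yT.
by apply: (H (x, y)); split; rewrite /= in_itv.
Qed.

(** The horizontal gradient of [w y + phi(x)] is [(phi', w |x|^a)]. Where its norm is at most 1,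
    Cauchy-Schwarz bounds the growth of this function by arc length. The condition stops at [tau],
    the remaining length being nonnegative, so intermediate points of a curve are controlled too. *)
Lemma calibration_le {R : realType} (a T tau w L : R) (g : R -> R * R) (phi dphi : R -> R) :
  0 < tau <= T -> horizontal a T g ->
  (forall x : R, is_derive x 1 phi (dphi x)) ->
  (forall x y, `|phi x - phi y| <= L * `|x - y|) ->
  (forall t, 0 <= t <= tau -> dphi (g t).1 ^+ 2 + (w * `|(g t).1| `^ a) ^+ 2 <= 1) ->
  ((w * (g tau).2 + phi (g tau).1 - (w * (g 0).2 + phi (g 0).1))%:E <= sr_length a T g)%E.
Proof.
move=> /andP[tau0 tauT] [/lipschitz_itvP[M M0 gM] [c [d [_ _ hae]]]] dphiE phiL cs.
have L0 : 0 <= L by have := phiL 1 0; rewrite subr0 normr1 mulr1; apply: le_trans.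
pose e t := sr_norm a (g t) (derive1 g t).
have e0 t : (0 <= e t)%E by exact: sr_norm_ge0.
apply: (@le_trans _ _ (\int[lebesgue_measure]_(t in `[0%R, tau]) e t)%E); last first.
  rewrite /sr_length integral_mkcond [leRHS]integral_mkcond.
  apply: ge0_le_integral_all => t _; first exact: erestrict_ge0.
  rewrite !patchE; case: ifPn => [|_]; last by case: ifPn => // _; exact: e0.
  rewrite inE/= in_itv/= => /andP[t0 tt]; rewrite mem_set//= in_itv/= t0.
  exact: le_trans tauT.
apply: (@lipschitz_le_integral _ (fun t => w * (g t).2 + phi (g t).1) e (`|w| * M + L * M)) => //.
  move=> x y /andP[x0 xt] /andP[y0 yt].
  have gxy : `|g x - g y| <= M * `|x - y|.
    by apply: gM; rewrite ?x0 ?y0; apply: le_trans tauT.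
  have [g1 g2] := prod_norm_le (g x - g y).
  have -> : w * (g x).2 + phi (g x).1 - (w * (g y).2 + phi (g y).1) =
    w * ((g x).2 - (g y).2) + (phi (g x).1 - phi (g y).1) by ring.
  apply: le_trans (ler_normD _ _) _; rewrite normrM mulrDl lerD//.
    by rewrite -mulrA ler_wpM2l// (le_trans g2).
  by apply: le_trans (phiL _ _) _; rewrite -mulrA ler_wpM2l// (le_trans g1).
case: hae => N [mN N0 NP]; exists N; split => //.
apply: subset_trans NP; apply: subsetC => t /= H; rewrite in_itv/= => tt.
have {H} : is_derive t 1 g (c t *: vfX (g t) + d t *: vfY a (g t)).
  by apply: H; rewrite in_itv/=; case/andP: tt => ->/le_trans; apply.
set v := (X in is_derive _ _ _ X); move: v => v dg.
exists (w * v.2 + dphi (g t).1 * v.1).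
  apply: is_deriveD.
    have : is_derive t 1 (w \*: (fun s => (g s).2)) (w *: v.2).
      by apply: is_deriveZ; exact: ((is_derive_pairP _ _ _).1 dg).2.
    by [].
  by apply: (is_derive1_comp (dphiE _)); exact: ((is_derive_pairP _ _ _).1 dg).1.
rewrite /e /sr_norm.
have -> : derive1 g t = v by rewrite derive1E; have [_ ->] := dg.
apply: le_ereal_inf_tmp => _ [[c' d'] /= vE <-]; rewrite lee_fin.
rewrite vE /vfX /vfY/= /GRing.scale/= mulr1 !mulr0 addr0 add0r.
have -> : w * (d' * `|(g t).1| `^ a) + dphi (g t).1 * c' =
   dphi (g t).1 * c' + (w * `|(g t).1| `^ a) * d' by ring.
by apply: dot_le_sqrt; exact: cs.
Qed.

(** * Monotone bi-Lipschitz functions and the weight [x^(2 al)] *)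

Lemma derive_le_slope {R : realType} (f g df dg : R -> R) (a b : R) :
  a <= b -> continuous f -> continuous g ->
  (forall x, a < x < b -> is_derive x 1 f (df x)) ->
  (forall x, a < x < b -> is_derive x 1 g (dg x)) ->
  (forall x, a < x < b -> df x <= dg x) ->
  f b - f a <= g b - g a.
Proof.
rewrite le_eqVlt => /predU1P[->|ab] cf cg hf hg fg; first by rewrite !subrr.
have [x|//|x] := @MVT R (g - f) (dg - df) a b ab.
- by rewrite in_itv/= => xab; apply: is_deriveB; [exact: hg|exact: hf].
- by apply: continuous_subspaceT => z; apply: cvgB; [exact: cg|exact: cf].
rewrite in_itv/= => xab E.
have {}E : g b - f b - (g a - f a) = (dg x - df x) * (b - a) := E.
have := fg x xab; rewrite -subr_ge0 => dx.
have : 0 <= (dg x - df x) * (b - a) by rewrite mulr_ge0// subr_ge0 ltW.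
rewrite -E; lra.
Qed.

Lemma derive_norm_le {R : realType} (f df : R -> R) (L : R) :
  (forall x : R, is_derive x 1 f (df x)) -> (forall x, `|df x| <= L) ->
  forall x y, `|f x - f y| <= L * `|x - y|.
Proof.
move=> hf fL x y; wlog xy : x y / x <= y => [H|].
  by case: (leP x y) => [|/ltW] xy; [|rewrite distrC (distrC x)]; exact: H.
have cf : continuous f by move=> z; exact: is_derive1_continuous (hf z).
have [c _ fE] := MVT_segment xy (fun z _ => hf z) (continuous_subspaceT cf).
by rewrite distrC (distrC x) fE normrM ler_wpM2r.
Qed.

Lemma derive0_cst {R : realType} (f : R -> R) (a b : R) :
  continuous f -> (forall x, a < x < b -> is_derive x 1 f 0) ->
  forall x, a <= x <= b -> f x = f a.
Proof.
move=> cf hf x /andP[ax xb].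
have h0 z : a < z < x -> is_derive z 1 (cst 0 : R -> R) 0 by move=> _; exact: is_derive_cst.
have h1 z : a < z < x -> is_derive z 1 f 0.
  by case/andP=> az zx; apply: hf; rewrite az (lt_le_trans zx).
have c0 : continuous (cst 0 : R -> R) by exact: cst_continuous.
have := derive_le_slope _ _ _ _ _ _ ax cf c0 h1 h0 (fun _ _ => lexx _).
have := derive_le_slope _ _ _ _ _ _ ax c0 cf h0 h1 (fun _ _ => lexx _).
rewrite /cst; lra.
Qed.

(** Increments are signed, so for [m > 0] the condition includes strict monotonicity. *)
Definition bilipschitz {R : realType} (m M : R) (f : R -> R) :=
  forall x y, x <= y -> m * (y - x) <= f y - f x <= M * (y - x).

Lemma bilipschitz_continuous {R : realType} (m M : R) (f : R -> R) :
  0 <= m -> bilipschitz m M f -> continuous f.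
Proof.
move=> m0 fmM; apply: (@lipschitz_continuous _ f M) => x y.
wlog xy : x y / x <= y => [H|].
  by case: (leP x y) => [|/ltW] xy; [|rewrite distrC (distrC x)]; exact: H.
have /andP[h1 h2] := fmM x y xy.
rewrite distrC (distrC x) (ger0_norm (_ : 0 <= y - x)) ?subr_ge0// ger0_norm//.
by apply: le_trans h1; rewrite mulr_ge0// subr_ge0.
Qed.

Lemma bilipschitz_derive {R : realType} (m M : R) (f df : R -> R) :
  (forall x : R, is_derive x 1 f (df x)) -> (forall x, m <= df x <= M) -> bilipschitz m M f.
Proof.
move=> hf fmM x y xy.
have cf : continuous f by move=> z; exact: is_derive1_continuous (hf z).
have [c _ ->] := MVT_segment xy (fun z _ => hf z) (continuous_subspaceT cf).
by have /andP[h1 h2] := fmM c; rewrite !ler_wpM2r// subr_ge0.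
Qed.

Lemma bilipschitz_le {R : realType} (m M : R) (f : R -> R) :
  0 < m -> bilipschitz m M f -> forall x y, (f x <= f y) = (x <= y).
Proof.
move=> m0 fmM x y; apply/idP/idP => [|xy].
  apply: contraTT; rewrite -!ltNge => yx.
  have /andP[h _] := fmM _ _ (ltW yx).
  by rewrite -subr_gt0; apply: lt_le_trans h; rewrite mulr_gt0// subr_gt0.
have /andP[h _] := fmM _ _ xy.
by rewrite -subr_ge0; apply: le_trans h; rewrite mulr_ge0 ?(ltW m0)// subr_ge0.
Qed.

Lemma bilipschitz_ge {R : realType} (m M : R) (f : R -> R) (x y : R) :
  0 <= m -> bilipschitz m M f -> m * `|x - y| <= `|f x - f y|.
Proof.
move=> m0 fmM; wlog xy : x y / x <= y => [H|].
  by case: (leP x y) => [|/ltW] xy; [|rewrite distrC [leRHS]distrC]; exact: H.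
have /andP[h _] := fmM x y xy; rewrite distrC [leRHS]distrC.
rewrite (ger0_norm (_ : 0 <= y - x)) ?subr_ge0//.
by apply: (le_trans h); exact: ler_norm.
Qed.

(* Outside of the box [|X - z| <= d], [|w| <= om] the height is extended affinely
   in [w], which makes [f] globally bi-Lipschitz on every fiber. *)
Lemma bilipschitz_inverse {R : realType} (m M : R) (f : R -> R) :
  0 < m -> bilipschitz m M f ->
  exists h, [/\ cancel f h, cancel h f & bilipschitz M^-1 m^-1 h].
Proof.
move=> m0 fmM.
have fle := bilipschitz_le _ _ _ m0 fmM.
have cf := bilipschitz_continuous _ _ _ (ltW m0) fmM.
have M0 : 0 < M.
  have /andP[h1 h2] := fmM 0 1 ler01; move: (le_trans h1 h2).
  by rewrite subr0 !mulr1; apply: lt_le_trans.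
have surj y : exists x, f x = y.
  pose r := `|y - f 0| / m.
  have r0 : 0 <= r by rewrite divr_ge0// ltW.
  have rE : m * r = `|y - f 0| by rewrite /r mulrCA mulfV ?mulr1// gt_eqF.
  have h : - r <= r by lra.
  have /andP[h1 _] := fmM 0 r r0.
  have /andP[h2 _] : m * (0 - (- r)) <= f 0 - f (- r) <= M * (0 - (- r)) by apply: fmM; lra.
  have yn := ler_norm (y - f 0); have yn' := ler_norm (- (y - f 0)); rewrite normrN in yn'.
  have [|x _ <-] := @IVT R f (- r) r y h (continuous_subspaceT cf); last by exists x.
  rewrite min_l ?fle// max_r ?fle//.
  by apply/andP; split; lra.
have [h hK] := choice surj.
have fK : cancel f h.
  move=> x; apply/eqP; rewrite eq_le; apply/andP.
  by split; rewrite -fle; rewrite hK lexx.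
exists h; split => // x y xy.
have hxy : h x <= h y by rewrite -fle !hK.
have := fmM _ _ hxy; rewrite !hK => /andP[h1 h2].
by rewrite ler_pdivrMl// h2 ler_pdivlMl.
Qed.

Lemma dblpow_ge0 {R : realType} (x s : R) : 0 <= dblpow x s.
Proof. by rewrite /dblpow powR_ge0. Qed.

Lemma dblpow_norm {R : realType} (x s : R) : (`|x| `^ s) ^+ 2 = dblpow x s.
Proof. by rewrite /dblpow -(real_normK (num_real x)) !expr2 powRM. Qed.

Lemma dblpowB1 {R : realType} (x s : R) : 1 <= s -> dblpow x s = x * (dblpow x (s - 1) * x).
Proof.
move=> s1; rewrite /dblpow -(@mulr_powRB1 _ (x ^+ 2)) ?sqr_ge0//; last lra.
by rewrite expr2; ring.
Qed.

Lemma dblpow_le {R : realType} (x y s : R) : 0 <= s -> `|x| <= y -> dblpow x s <= dblpow y s.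
Proof.
move=> s0 xy; apply: ge0_ler_powR; rewrite ?nnegrE ?sqr_ge0//.
by rewrite -[x ^+ 2]real_normK ?num_real// ler_sqr ?nnegrE// (le_trans _ xy).
Qed.

Lemma is_derive_sqr {R : realType} (f : R -> R) (x d : R) :
  is_derive x 1 f d -> is_derive x 1 (fun y => f y ^+ 2) (2 * f x * d).
Proof.
move=> df; have -> : (fun y => f y ^+ 2) = f * f by apply/funext => y; rewrite expr2.
by apply: is_derive_eq; rewrite /GRing.scale/=; ring.
Qed.

Lemma is_derive_dblpow {R : realType} (s x : R) : 1 <= s ->
  is_derive x 1 (fun x => dblpow x s) (2 * s * (dblpow x (s - 1) * x)).
Proof.
move=> s1; have [->|x0] := eqVneq x 0.
  (* The power rule asks for a positive base [x ^+ 2]. At the origin the slope function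
     [z |-> dblpow z (s - 1) * z] is used; it is bounded by [|z|] near 0, also for [s = 1]. *)
  rewrite !mulr0; apply/is_derive1_caratheodory.
  exists (fun z => dblpow z (s - 1) * z); split; last by rewrite mulr0.
    move=> z; rewrite (dblpowB1 z)// (dblpowB1 0)//; ring.
  apply/cvgrPdist_le => /= e e0.
  near=> z; rewrite mulr0 sub0r normrN normrM (ger0_norm (dblpow_ge0 _ _)).
  apply: (@le_trans _ _ (1 * `|z|)).
    have d1 : dblpow 1 (s - 1) = 1 :> R by rewrite /dblpow expr1n powR1.
    apply: ler_wpM2r => //; rewrite -[leRHS]d1.
    apply: dblpow_le; first lra.
    by near: z; exists 1 => //= z /=; rewrite sub0r normrN => /ltW.
  rewrite mul1r; near: z; exists e => //= z /=.
  by rewrite sub0r normrN => /ltW.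
have x2 : 0 < x ^+ 2 by rewrite exprn_even_gt0.
have := @is_derive1_comp _ (fun y => y `^ s) (fun y => y ^+ 2) x _ _
  (is_derive1_powR s x2) (is_derive_sqr _ _ _ (is_derive_id x 1)).
move=> H; apply: (is_derive_eq H).
by rewrite /dblpow mulr1 /=; ring.
Unshelve. all: by end_near. Qed.

Lemma is_derive_dblpow_primitive {R : realType} (s x : R) : 1 <= s ->
  is_derive x 1 (fun x => dblpow x s * x / (2 * s + 1)) (dblpow x s).
Proof.
move=> s1; have h := is_derive_dblpow s x s1.
have h1 := is_deriveM h (is_derive_id x (1 : R)).
have h2 := is_deriveZ (2 * s + 1)^-1 h1.
have e : (2 * s + 1)^-1 *: ((fun x => dblpow x s) * id) = (fun x => dblpow x s * x / (2 * s + 1)).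
  by apply/funext => z; rewrite [RHS]mulrC.
rewrite -e; apply: (is_derive_eq h2).
rewrite /GRing.scale/= (dblpowB1 x)//.
field; lra.
Qed.

(** * Quadratures for the geodesics *)

Lemma clamp_norm {R : realType} (M x : R) : 0 <= M -> `|clamp (- M) M x| <= M.
Proof. by move=> M0; rewrite ler_norml; apply: clamp_itv; lra. Qed.

Lemma continuous_clamp {R : realType} (a b : R) : continuous (clamp a b).
Proof. by apply: (lipschitz_continuous _ 1) => x y; rewrite mul1r clamp_lipschitz. Qed.

Definition primitive {R : realType} (k : R -> R) (c : R) : R -> R :=
  get [set K | K c = 0 /\ forall x : R, is_derive x 1 K (k x)].

Lemma primitiveP {R : realType} (k : R -> R) (c : R) : continuous k ->
  primitive k c c = 0 /\ forall x : R, is_derive x 1 (primitive k c) (k x).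
Proof.
move=> /(continuous_primitive _ c)[K HK]; rewrite /primitive.
exact: (@getI _ [set K | K c = 0 /\ forall x : R, is_derive x 1 K (k x)] K HK).
Qed.

Section arc_functions.
Context {R : realType} (al M x0 w : R).
Context (al1 : 1 <= al) (M0 : 0 < M) (wM : w ^+ 2 * dblpow M al < 1).

(* Clamping [x] keeps the radicand of [nn] positive, so that the quadratures are
   defined on the whole line; only [|x| <= M] matters. *)
Definition pw (x : R) : R := dblpow (clamp (- M) M x) al.
Definition nn (x : R) : R := Num.sqrt (1 - w ^+ 2 * pw x).
Definition arcA : R -> R := primitive (fun x => (nn x)^-1) x0.
Definition arcB : R -> R := primitive (fun x => w * pw x / nn x) x0.
Definition arcF : R -> R := primitive nn x0.

Let al0 : 0 <= al. Proof. exact: le_trans al1. Qed.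

Lemma pw_ge0 x : 0 <= pw x. Proof. exact: dblpow_ge0. Qed.

Lemma pw_le x : pw x <= dblpow M al.
Proof. by apply: dblpow_le => //; apply: clamp_norm; exact: ltW. Qed.

Lemma pwE x : `|x| <= M -> pw x = dblpow x al.
Proof. by rewrite ler_norml => xM; rewrite /pw clamp_id. Qed.

Lemma continuous_pw : continuous pw.
Proof.
move=> x; apply: (@continuous_comp _ _ _ (clamp (- M) M) (fun z => dblpow z al)).
  exact: continuous_clamp.
exact: is_derive1_continuous (is_derive_dblpow _ _ al1).
Qed.

Lemma one_sub_pw_gt0 x : 0 < 1 - w ^+ 2 * pw x.
Proof.
rewrite subr_gt0; apply: le_lt_trans wM; apply: ler_wpM2l; first exact: sqr_ge0.
exact: pw_le.
Qed.

Lemma nn_gt0 x : 0 < nn x. Proof. by rewrite sqrtr_gt0 one_sub_pw_gt0. Qed.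

Lemma nn_sqr x : nn x ^+ 2 = 1 - w ^+ 2 * pw x.
Proof. by rewrite sqr_sqrtr// ltW// one_sub_pw_gt0. Qed.

Lemma nn_le1 x : nn x <= 1.
Proof.
rewrite -[leRHS]sqrtr1 ler_wsqrtr// gerBl mulr_ge0 ?sqr_ge0//; exact: pw_ge0.
Qed.

Lemma continuous_nn : continuous nn.
Proof.
move=> x; apply: continuous_comp; last exact: sqrt_continuous.
apply: cvgB; first exact: cvg_cst.
by apply: (@cvgM _ R); [exact: cvg_cst|exact: continuous_pw].
Qed.

Lemma continuous_nnV : continuous (fun x => (nn x)^-1).
Proof.
by move=> x; apply: cvgV; [rewrite gt_eqF// nn_gt0|exact: continuous_nn].
Qed.

Lemma arcA0 : arcA x0 = 0.
Proof. exact: (primitiveP _ _ continuous_nnV).1. Qed.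

Lemma is_derive_arcA (x : R) : is_derive x 1 arcA (nn x)^-1.
Proof. exact: (primitiveP _ _ continuous_nnV).2. Qed.

Lemma continuous_arcB_integrand : continuous (fun x => w * pw x / nn x).
Proof.
move=> x; apply: (@cvgM _ R); last exact: continuous_nnV.
by apply: (@cvgM _ R); [exact: cvg_cst|exact: continuous_pw].
Qed.

Lemma arcB0 : arcB x0 = 0.
Proof. exact: (primitiveP _ _ continuous_arcB_integrand).1. Qed.

Lemma is_derive_arcB (x : R) : is_derive x 1 arcB (w * pw x / nn x).
Proof. exact: (primitiveP _ _ continuous_arcB_integrand).2. Qed.

Lemma arcF0 : arcF x0 = 0.
Proof. exact: (primitiveP _ _ continuous_nn).1. Qed.

Lemma is_derive_arcF (x : R) : is_derive x 1 arcF (nn x).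
Proof. exact: (primitiveP _ _ continuous_nn).2. Qed.

(** Since [n^2 + w^2 p = 1], the integrands satisfy [1 / n = w (w p / n) + n]. Along the arc the
    calibration thus grows exactly as arc length does. *)
Lemma arcA_split x : arcA x = w * arcB x + arcF x.
Proof.
pose h := arcA - (w \*: arcB + arcF).
have dh (z : R) : is_derive z 1 h 0.
  have := is_deriveB (is_derive_arcA z)
    (is_deriveD (is_deriveZ w (is_derive_arcB z)) (is_derive_arcF z)).
  move=> H; apply: (is_derive_eq H).
  have n0 : nn z != 0 by rewrite gt_eqF// nn_gt0.
  have := nn_sqr z; rewrite /GRing.scale/= => E.
  apply: (mulIf n0); rewrite mul0r mulrBl mulrDl mulVf// -!mulrA mulVf//.
  rewrite mulr1 -expr2 E; ring.
have := is_derive_0_is_cst x x0 dh.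
rewrite /h /= => E.
have {}E : arcA x - (w * arcB x + arcF x) = arcA x0 - (w * arcB x0 + arcF x0) := E.
move: E; rewrite arcA0 arcB0 arcF0; lra.
Qed.

(** The hypothesis on [k] is a form, free of square roots, of [n >= 1 / k] on the strip; smallness
    of the width is always passed on in this shape. *)
Lemma arcA_bilipschitz k : 0 < k -> k ^- 2 <= 1 - w ^+ 2 * dblpow M al ->
  bilipschitz 1 k arcA.
Proof.
move=> k0 kM; apply: bilipschitz_derive is_derive_arcA _ => x.
have n0 := nn_gt0 x; rewrite invf_ge1// nn_le1/=.
rewrite -[leRHS]invrK lef_pV2 ?posrE ?invr_gt0//.
rewrite -(@ler_pXn2r _ 2)// ?nnegrE ?invr_ge0 ?(ltW n0) ?(ltW k0)// nn_sqr exprVn; apply: le_trans kM _.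
by rewrite lerD2l lerN2 ler_wpM2l ?sqr_ge0// pw_le.
Qed.

Lemma arcA_bilipschitz_ex : exists2 k, 0 < k & bilipschitz 1 k arcA.
Proof.
have h : 0 < 1 - w ^+ 2 * dblpow M al by rewrite subr_gt0.
exists (Num.sqrt (1 - w ^+ 2 * dblpow M al))^-1; first by rewrite invr_gt0 sqrtr_gt0.
by apply: arcA_bilipschitz; rewrite ?invr_gt0 ?sqrtr_gt0// exprVn invrK sqr_sqrtr// ltW.
Qed.

Lemma arcF_lipschitz x y : `|arcF x - arcF y| <= 1 * `|x - y|.
Proof.
apply: derive_norm_le is_derive_arcF _ _ _ => z.
by rewrite ger0_norm ?nn_le1// ltW// nn_gt0.
Qed.

End arc_functions.

(** Hamilton's equations are one-sided at the endpoints and say nothing outside [[0, 1]]. The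
    clamped function is continuous on the line and has ordinary derivatives inside, as mean value
    arguments require. *)
Lemma is_derive_in_clamp {R : realType} (f d : R -> R) :
  (forall t : R, 0 <= t <= 1 -> is_derive_in `[0, 1] f t (d t)) ->
  continuous (fun t : R => f (clamp 0 1 t)) /\
  forall t : R, 0 < t < 1 -> is_derive t 1 (fun t : R => f (clamp 0 1 t)) (d t).
Proof.
move=> hf.
have near_q (t e : R) : 0 <= t <= 1 -> 0 < e -> \forall s \near t,
    s != t -> 0 <= s <= 1 -> `|d t - (s - t)^-1 * (f s - f t)| < e.
  move=> t01 e0; have /cvgrPdist_lt/(_ e e0) := hf t t01.
  rewrite near_withinE /dnbhs near_withinE; apply: filterS => s H st s01.
  by apply: H => //; rewrite /= in_itv.
split=> [t|t /andP[t0 t1]].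
  apply/cvgrPdist_le => /= e e0; set c := clamp 0 1 t.
  have c01 : 0 <= c <= 1 by exact: clamp_itv.
  have [r /= r0 hr] := near_q c 1 c01 ltr01.
  pose K := `|d c| + 1.
  have K0 : 0 < K by rewrite /K ltr_wpDl.
  near=> s; set cs := clamp 0 1 s.
  have cs01 : 0 <= cs <= 1 by exact: clamp_itv.
  have cc : `|c - cs| <= `|t - s| by exact: clamp_lipschitz.
  have [->|ne] := eqVneq cs c; first by rewrite subrr normr0 ltW.
  have tsr : `|t - s| < r by near: s; exists r.
  have tse : `|t - s| < e / K by near: s; exists (e / K) => //=; rewrite divr_gt0.
  have := hr cs (le_lt_trans cc tsr) ne cs01.
  set q := _^-1 * _ => dq.
  have qK : `|q| <= K.
    by have := ler_normD (q - d c) (d c); rewrite subrK (distrC q) /K; lra.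
  have -> : f c - f cs = - (q * (cs - c)).
    by rewrite /q mulrAC mulVf ?mul1r ?opprB// subr_eq0.
  rewrite normrN normrM distrC; move: tse; rewrite ltr_pdivlMr// => tse.
  have := normr_ge0 (c - cs); have := normr_ge0 q; nra.
pose F z := f (clamp 0 1 z).
have Ft : F t = f t by rewrite /F clamp_id// !ltW.
apply/is_derive1_caratheodory.
exists (fun z => if z == t then d t else (F z - F t) / (z - t)); split; last by rewrite eqxx.
  move=> z; case: eqP => [->|/eqP zt]; first by rewrite !subrr mulr0.
  by rewrite divfK// subr_eq0.
have t01 : 0 <= t <= 1 by rewrite !ltW.
apply/cvgrPdist_le => /= e e0; have nq := near_q t e t01 e0; near=> z; rewrite eqxx.
case: eqP => [_|/eqP zt]; first by rewrite subrr normr0 ltW.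
have z01 : 0 <= z <= 1.
  apply/andP; split; near: z.
    by move/lt_nbhsr: t0; apply: filterS => z /ltW.
  by move/lt_nbhsl: t1; apply: filterS => z /ltW.
rewrite Ft /F clamp_id// mulrC; apply/ltW; move: zt z01.
by near: z.
Unshelve. all: by end_near. Qed.

(** Calibration by [x] and by [- x], whose gradients have norm 1. As [tau] is any time, the whole
    curve is confined to a strip around its starting abscissa. *)
Lemma horizontal_fst_le {R : realType} (a T tau : R) (g : R -> R * R) :
  0 < tau <= T -> horizontal a T g ->
  (`|(g tau).1 - (g 0).1|%:E <= sr_length a T g)%E.
Proof.
move=> tauT hg.
have idL (x y : R) : `|x - y| <= 1 * `|x - y| by rewrite mul1r.
have oppL (x y : R) : `|- x - - y| <= 1 * `|x - y| by rewrite mul1r -opprD normrN.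
have d1 (x : R) : is_derive x 1 id (cst 1 x) by exact: is_derive_id.
have d2 (x : R) : is_derive x 1 -%R (cst (- 1) x) by exact: is_deriveNid.
have h1 := calibration_le a T tau 0 1 g id (cst 1) tauT hg d1 idL.
have h2 := calibration_le a T tau 0 1 g -%R (cst (- 1)) tauT hg d2 oppL.
have [_|_] := ger0P ((g tau).1 - (g 0).1).
  have := h1 _; rewrite !mul0r !add0r; apply => t _.
  by rewrite /cst expr1n mul0r expr0n/= addr0.
have := h2 _; rewrite !mul0r !add0r -opprD; apply => t _.
by rewrite /cst sqrrN expr1n mul0r expr0n/= addr0.
Qed.

Lemma is_derive_inW {R : realType} (D : set R) (f : R -> R) (t d : R) :
  is_derive t 1 f d -> is_derive_in D f t d.
Proof.
move=> /is_derive1_caratheodory[q [fE cq <-]].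
have : q s @[s --> within D t^'] --> q t.
  by apply: cvg_trans cq; apply: cvg_app => P; rewrite /within/=; apply: filterS.
apply: cvg_trans; apply: near_eq_cvg.
apply: filterS (_ : (within D t^') [set s | s != t]); last first.
  have : nbhs t [set s | s != t -> D s -> s != t] by apply: filterE => s.
  exact.
move=> s /= st; rewrite fE mulrC mulfK// subr_eq0//.
Unshelve. all: by end_near. Qed.

Lemma is_derive_unique {R : realType} (f : R -> R) (t d d' : R) :
  is_derive t 1 f d -> is_derive t 1 f d' -> d = d'.
Proof. by move=> [_ <-] [_ <-]. Qed.

Lemma L2_on_continuous {R : realType} (T : R) (f : R -> R) : continuous f -> L2_on T f.
Proof.
move=> cf; split.
  apply: subspace_continuous_measurable_fun => //.
  exact: continuous_subspaceT.
have cf2 : continuous (fun t => f t ^+ 2).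
  by move=> t; rewrite (_ : (fun t => _) = f * f)//; apply: (@cvgM _ R); exact: cf.
have : lebesgue_measure.-integrable `[0, T] (EFin \o (fun t => f t ^+ 2)).
  by apply: continuous_compact_integrable; [exact: segment_compact|exact: continuous_subspaceT].
move=> /integrableP[_]; apply: le_lt_trans; apply/ge0_le_integral_all => x _ /=.
  by rewrite lee_fin sqr_ge0.
by rewrite lee_fin ler_norm.
Qed.

(** * Minimality and uniqueness of the arcs *)

Section arc_geodesics.
Context {R : realType} (al M x0 y0 w X : R).
Context (al1 : 1 <= al) (M0 : 0 < M) (wM : w ^+ 2 * dblpow M al < 1).

Local Notation A := (arcA al M x0 w).
Local Notation B := (arcB al M x0 w).
Local Notation F := (arcF al M x0 w).
Local Notation n := (nn al M w).
Local Notation P := (pw al M).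

Let A0 : A x0 = 0 := arcA0 al M x0 w al1 M0 wM.
Let B0 : B x0 = 0 := arcB0 al M x0 w al1 M0 wM.
Let F0 : F x0 = 0 := arcF0 al M x0 w al1.
Let AE x : A x = w * B x + F x := arcA_split al M x0 w al1 M0 wM x.
Let nE x : n x ^+ 2 = 1 - w ^+ 2 * P x := nn_sqr al M w al1 M0 wM x.
Let dF (x : R) : is_derive x 1 F (n x) := is_derive_arcF al M x0 w al1 x.
Let dA (x : R) : is_derive x 1 A (n x)^-1 := is_derive_arcA al M x0 w al1 M0 wM x.
Let dB (x : R) : is_derive x 1 B (w * P x / n x) :=
  is_derive_arcB al M x0 w al1 M0 wM x.

Lemma arcA_le_sr_length (T : R) (g : R -> R * R) :
  `|x0| + `|A X| <= M -> 0 < T -> horizontal al T g ->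
  g 0 = (x0, y0) -> g T = (X, y0 + B X) -> (`|A X|%:E <= sr_length al T g)%E.
Proof.
move=> AM T0 hg g0 gT; rewrite leNgt; apply/negP => gA.
(* The competitor is assumed shorter than [|A X|], and only this keeps it where the clamped weight
   agrees with [x^(2 al)]. *)
have xM t : 0 <= t <= T -> `|(g t).1| <= M.
  rewrite le_eqVlt => /andP[/predU1P[<- _|t0 tT]].
    by rewrite g0/=; apply: le_trans AM; rewrite lerDl.
  have tT' : 0 < t <= T by rewrite t0.
  have := le_lt_trans (horizontal_fst_le al T t g tT' hg) gA.
  rewrite lte_fin g0/= => h.
  have := ler_normD ((g t).1 - x0) x0; rewrite subrK; lra.
(* The sign selects the calibration or its opposite, as the arc may run to the left. *)
pose s : R := Num.sg (A X).
have sL (x y : R) : `|(s \*: F) x - (s \*: F) y| <= 1 * `|x - y|.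
  rewrite /= -mulrBr normrM; apply: (@le_trans _ _ (1 * `|F x - F y|)).
    by rewrite ler_wpM2r// /s normr_sg; case: (_ != 0).
  by rewrite mul1r; exact: (arcF_lipschitz al M x0 w al1 M0 wM).
have dsF (x : R) : is_derive x 1 (s \*: F) (s * n x) by exact: is_deriveZ.
have TT : 0 < T <= T by rewrite T0 lexx.
have s1 : s ^+ 2 <= 1 by rewrite /s sqr_sg; case: (_ != 0).
have : (`|A X|%:E < `|A X|%:E)%E; last by rewrite ltxx.
apply: le_lt_trans gA; apply: le_trans (calibration_le al T T (s * w) 1 g (s \*: F) _ TT hg dsF sL _).
  rewrite lee_fin g0 gT/= F0 /GRing.scale/= (_ : `|A X| = s * A X) ?AE; first lra.
  by rewrite -AE normrEsg.
move=> t tT; rewrite !exprMn dblpow_norm nE pwE ?xM//; nra.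
Qed.

Lemma is_derive_pw (x : R) : `|x| < M ->
  is_derive x 1 P (2 * al * (dblpow x (al - 1) * x)).
Proof.
move=> xM; apply: near_eq_is_derive (is_derive_dblpow _ x al1).
move: xM; rewrite ltr_norml => /andP[xM1 xM2].
near=> z; rewrite pwE// ler_norml; apply/andP; split.
  by near: z; move/lt_nbhsr: xM1; apply: filterS => z /ltW.
by near: z; move/lt_nbhsl: xM2; apply: filterS => z /ltW.
Unshelve. all: by end_near. Qed.

Lemma is_derive_nn (x : R) : `|x| < M ->
  is_derive x 1 n (- (w ^+ 2 * al * (dblpow x (al - 1) * x)) / n x).
Proof.
move=> xM.
have n2 : 0 < 1 - w ^+ 2 * P x := one_sub_pw_gt0 al M w al1 M0 wM x.
have n0 : n x != 0 by rewrite gt_eqF// nn_gt0.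
have d1 : is_derive x 1 (cst 1 - w ^+ 2 \*: P) (0 - w ^+ 2 * (2 * al * (dblpow x (al - 1) * x))).
  by apply: is_deriveB; apply: is_deriveZ; exact: is_derive_pw.
have := @is_derive1_comp _ Num.sqrt (cst 1 - w ^+ 2 \*: P) x _ _ (is_derive1_sqrt n2) d1.
move=> H; apply: (is_derive_eq H).
have -> : Num.sqrt (1 - w ^+ 2 * P x) = n x by [].
field.
by rewrite n0.
Qed.

Context (x0M : `|x0| < M) (XM : `|X| < M) (h : R -> R) (AK : cancel A h) (hK : cancel h A).

Local Notation c := (A X).
(** [A] is signed arc length, so this parametrisation has constant speed [|c|]. *)
Definition arc_x (t : R) : R := h (t * c).
Definition arc_curve (t : R) : R * R := (arc_x t, y0 + B (arc_x t)).

Lemma arcA_le x y : (A x <= A y) = (x <= y).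
Proof.
have [k k0 hk] := arcA_bilipschitz_ex al M x0 w al1 M0 wM.
exact: bilipschitz_le ltr01 hk x y.
Qed.

Lemma arc_xM (t : R) : 0 <= t <= 1 -> `|arc_x t| < M.
Proof.
move=> /andP[t0 t1]; move: x0M XM; rewrite !ltr_norml => /andP[x1 x2] /andP[x3 x4].
have [c0|/ltW c0] := leP 0 c.
  have : A x0 <= A (arc_x t) <= c by rewrite hK A0 mulr_ge0// ler_piMl.
  by rewrite !arcA_le => /andP[h1 h2]; apply/andP; split; lra.
have : c <= A (arc_x t) <= A x0.
  by rewrite hK A0 mulr_ge0_le0// ler_niMl.
by rewrite !arcA_le => /andP[h1 h2]; apply/andP; split; lra.
Qed.

Lemma is_derive_arc_x (t : R) : is_derive t 1 arc_x (c * n (arc_x t)).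
Proof.
have cA : continuous A by move=> z; exact: is_derive1_continuous (dA z).
have n0 z : n z != 0 by rewrite gt_eqF// nn_gt0.
have dh : is_derive (t * c) 1 h (n (h (t * c))).
  rewrite -{1}(hK (t * c)) -[X in is_derive _ _ _ X]invrK.
  apply: is_derive_inverse; rewrite ?invr_eq0//; first by near=> z; exact: AK.
  by near=> z; exact: cA.
have dm : is_derive t 1 (fun t => t * c) c.
  have := is_deriveM (is_derive_id t (1 : R)) (is_derive_cst c t (1 : R)).
  by move=> H; apply: (is_derive_eq H); rewrite /GRing.scale/= mulr1 mulr0 add0r.
have H := @is_derive1_comp _ h (fun t => t * c) t _ _ dh dm.
by apply: (is_derive_eq H); rewrite mulrC.
Unshelve. all: by end_near. Qed.

Lemma is_derive_arc_y (t : R) :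
  is_derive t 1 (fun s => y0 + B (arc_x s)) (w * c * P (arc_x t)).
Proof.
have H := @is_derive1_comp _ B arc_x t _ _ (dB (arc_x t)) (is_derive_arc_x t).
have H1 := is_deriveD (is_derive_cst y0 t (1 : R)) H.
apply: (is_derive_eq H1).
have n0 : n (arc_x t) != 0 by rewrite gt_eqF// nn_gt0.
by rewrite add0r; field.
Qed.

Lemma arc_curve_geodesic : geodesic al `[0, 1] arc_curve.
Proof.
(* The covector is the differential [(n, w)] of the calibration, scaled by the signed speed [c]. *)
exists (fun t => (c * n (arc_x t), w * c)) => t /=; rewrite in_itv/= => t01.
have xM := arc_xM t t01.
have n0 : n (arc_x t) != 0 by rewrite gt_eqF// nn_gt0.
split; apply: is_derive_inW.
- exact: is_derive_arc_x.
- by rewrite -(pwE al M) ?ltW//; exact: is_derive_arc_y.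
- have H := @is_derive1_comp _ n arc_x t _ _ (is_derive_nn _ xM) (is_derive_arc_x t).
  have H1 := is_deriveZ c H.
  apply: (is_derive_eq H1); rewrite /GRing.scale/=; field.
  exact: n0.
Qed.

Lemma continuous_arc_x : continuous arc_x.
Proof. by move=> t; exact: is_derive1_continuous (is_derive_arc_x t). Qed.

Lemma arc_curve_velocity (t : R) : 0 <= t <= 1 ->
  is_derive t 1 arc_curve ((c * n (arc_x t)) *: vfX (arc_curve t) +
    (w * c * Num.sqrt (P (arc_x t))) *: vfY al (arc_curve t)).
Proof.
move=> t01; have xM := arc_xM t t01.
apply/is_derive_pairP; rewrite /vfX /vfY /= /GRing.scale/= mulr1 !mulr0 addr0 add0r.
split; first exact: is_derive_arc_x.
apply: (is_derive_eq (is_derive_arc_y t)).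
by rewrite pwE ?ltW// -dblpow_norm sqrtr_sqr (ger0_norm (powR_ge0 _ _)) expr2 !mulrA.
Qed.

Lemma arc_curve_horizontal : horizontal al 1 arc_curve.
Proof.
split.
  pose Ly : R := `|w * c| * dblpow M al.
  have hx := derive_norm_le arc_x _ `|c| is_derive_arc_x _.
  have {}hx : forall x y, `|arc_x x - arc_x y| <= `|c| * `|x - y|.
    apply: hx => z; rewrite normrM ler_piMr// ger0_norm ?nn_le1// ltW// nn_gt0//.
  have hy : forall x y, `|(y0 + B (arc_x x)) - (y0 + B (arc_x y))| <= Ly * `|x - y|.
    apply: (derive_norm_le _ _ Ly is_derive_arc_y) => z.
    by rewrite normrM ler_wpM2l// ger0_norm ?pw_ge0// pw_le.
  have Ly0 : 0 <= Ly by rewrite mulr_ge0// dblpow_ge0.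
  exists (`|c| + Ly); split; first exact: num_real.
  move=> K KL [x y] _ /=; apply: (@le_trans _ _ ((`|c| + Ly) * `|x - y|)).
    rewrite prod_normE ge_max /=; apply/andP; split.
      by apply: le_trans (hx x y) _; rewrite ler_wpM2r// lerDl.
    by apply: le_trans (hy x y) _; rewrite ler_wpM2r// lerDr.
  by rewrite ler_wpM2r// ltW.
(* [Num.sqrt P] is [|x|^al] on the strip and, thanks to the clamp, continuous along the arc for all
   times. *)
exists (fun t => c * n (arc_x t)), (fun t => w * c * Num.sqrt (P (arc_x t))); split.
- apply: L2_on_continuous => t; apply: (@cvgM _ R); first exact: cvg_cst.
  by apply: continuous_comp; [exact: continuous_arc_x|exact: continuous_nn].
- apply: L2_on_continuous => t; apply: (@cvgM _ R); first exact: cvg_cst.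
  apply: (@continuous_comp _ _ _ (P \o arc_x) Num.sqrt); last exact: sqrt_continuous.
  by apply: continuous_comp; [exact: continuous_arc_x|exact: continuous_pw].
- apply: aeW => t; rewrite in_itv/= => t01; exact: arc_curve_velocity.
Qed.

Lemma arc_curve_length : (sr_length al 1 arc_curve <= `|c|%:E)%E.
Proof.
rewrite /sr_length.
apply: (@le_trans _ _ (\int[lebesgue_measure]_(t in `[0%R, 1%R]) (cst `|c|%:E t))%E); last first.
  by rewrite integral_cst//= lebesgue_measure_itv/= lte_fin ltr01 sube0 mule1.
apply: ge0_le_integral_all => t; rewrite /= in_itv/= => t01; first exact: sr_norm_ge0.
have dv := arc_curve_velocity t t01.
apply: ereal_inf_lbound; exists (c * n (arc_x t), w * c * Num.sqrt (P (arc_x t))) => /=.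
  by rewrite derive1E; have [_ ->] := dv.
congr EFin; rewrite !exprMn nE sqr_sqrtr ?pw_ge0//.
rewrite (_ : _ + _ = c ^+ 2) ?sqrtr_sqr//; ring.
Qed.

Lemma arc_curve0 : arc_curve 0 = (x0, y0).
Proof. by rewrite /arc_curve /arc_x mul0r -A0 AK B0 addr0. Qed.

Lemma arc_curve1 : arc_curve 1 = (X, y0 + B X).
Proof. by rewrite /arc_curve /arc_x mul1r AK. Qed.

Lemma sr_dist_arc : `|x0| + `|c| <= M -> sr_dist al (x0, y0) (X, y0 + B X) = `|c|%:E.
Proof.
move=> cM; apply/eqP; rewrite eq_le; apply/andP; split.
  apply: le_trans arc_curve_length; apply: ereal_inf_lbound.
  exists 1, arc_curve; split; [exact: ltr01|exact: arc_curve_horizontal|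
    exact: arc_curve0|exact: arc_curve1|by []].
apply: le_ereal_inf_tmp => _ [T [g [T0 hg g0 gT ->]]].
exact: arcA_le_sr_length.
Qed.

Lemma arc_curve_minimising : `|x0| + `|c| <= M -> minimising al 1 arc_curve.
Proof.
move=> cM; split; first exact: arc_curve_horizontal.
rewrite arc_curve0 arc_curve1 sr_dist_arc//; apply/eqP; rewrite eq_le arc_curve_length/=.
by apply: arcA_le_sr_length => //; [exact: arc_curve_horizontal|exact: arc_curve0|exact: arc_curve1].
Qed.

(** Off the line [x = 0] the vertical coefficient of the velocity is forced to be [v |x|^al]; on it,
    the vertical part of the energy vanishes. Only this inequality is needed to compare the energy
    of an extremal with its length. *)
Lemma extremal_speed_le (g l : R -> R * R) (v e2 : R) (t : R) :
  is_derive t 1 g ((l t).1, v * dblpow (g t).1 al) ->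
  e2 = (l t).1 ^+ 2 + v ^+ 2 * dblpow (g t).1 al ->
  ((Num.sqrt e2)%:E <= sr_norm al (g t) (derive1 g t))%E.
Proof.
move=> dg e2E; rewrite derive1E; have [_ ->] := dg.
apply: le_ereal_inf_tmp => _ [[c' d'] /= + <-]; rewrite lee_fin.
move=> /[dup] /(congr1 fst)/= + /(congr1 snd)/=.
rewrite /vfX /vfY/= /GRing.scale/= mulr1 !mulr0 addr0 add0r.
set r := `|(g t).1| `^ al => uE vE.
apply: ler_wsqrtr; rewrite e2E uE lerD2l.
move: vE; rewrite -dblpow_norm -/r expr2 mulrA => vE.
have [r0|r0] := eqVneq r 0; first by rewrite r0 mul0r mulr0 sqr_ge0.
by rewrite -(mulIf r0 vE) exprMn expr2.
Qed.

Lemma arc_curve_unique (g : R -> R * R) :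
  X != x0 -> `|x0| + `|c| <= M -> geodesic al `[0, 1] g -> minimising al 1 g ->
  g 0 = (x0, y0) -> g 1 = (X, y0 + B X) ->
  forall t, 0 <= t <= 1 -> g t = arc_curve t.
Proof.
move=> Xx0 cM [l ext] [hg lg] g0 g1.
have c0 : c != 0 by rewrite -A0 (inj_eq (can_inj AK)).
have lenE : sr_length al 1 g = `|c|%:E by rewrite lg g0 g1 sr_dist_arc.
have [cx dx] := is_derive_in_clamp (fun s => (g s).1) (fun t => (l t).1)
   (fun t ht => let: And4 e _ _ _ := ext t ht in e).
have [cy dy] := is_derive_in_clamp (fun s => (g s).2) (fun t => (l t).2 * dblpow (g t).1 al)
   (fun t ht => let: And4 _ e _ _ := ext t ht in e).
have [cu du] := is_derive_in_clamp (fun s => (l s).1)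
   (fun t => - (al * (l t).2 ^+ 2 * dblpow (g t).1 (al - 1) * (g t).1))
   (fun t ht => let: And4 _ _ e _ := ext t ht in e).
have [cv dv] := is_derive_in_clamp (fun s => (l s).2) (fun t => 0)
   (fun t ht => let: And4 _ _ _ e := ext t ht in e).
pose x t := (g (clamp 0 1 t)).1; pose y t := (g (clamp 0 1 t)).2.
pose u t := (l (clamp 0 1 t)).1; pose v := (l (clamp 0 1 0)).2.
have gE t : 0 <= t <= 1 -> g t = (x t, y t).
  by move=> t01; rewrite /x /y clamp_id//; case: (g t).
have lE t : 0 <= t <= 1 -> l t = (u t, v).
  move=> t01; have := derive0_cst _ 0 1 cv dv t t01.
  by rewrite /v /u /= => <-; rewrite clamp_id//; case: (l t).
have W (t : R) : 0 < t < 1 -> 0 <= t <= 1 by case/andP=> *; rewrite !ltW.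
have {}dx (t : R) : 0 < t < 1 -> is_derive t 1 x (u t).
  by move=> t01; have := dx t t01; rewrite lE// W.
have {}dy (t : R) : 0 < t < 1 -> is_derive t 1 y (v * dblpow (x t) al).
  by move=> t01; have := dy t t01; rewrite lE ?gE ?W.
have {}du (t : R) : 0 < t < 1 ->
    is_derive t 1 u (- (al * v ^+ 2 * dblpow (x t) (al - 1) * x t)).
  by move=> t01; have := du t t01; rewrite lE ?gE ?W.
have ddbl (z : R) := is_derive_dblpow al z al1.
have cdbl : continuous (fun z : R => dblpow z al).
  by move=> z; exact: is_derive1_continuous (ddbl z).
pose e2 := u 0 ^+ 2 + v ^+ 2 * dblpow (x 0) al.
have energy t : 0 <= t <= 1 -> u t ^+ 2 + v ^+ 2 * dblpow (x t) al = e2.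
  apply: (derive0_cst (fun t => u t ^+ 2 + v ^+ 2 * dblpow (x t) al)).
    move=> z; apply: cvgD.
      by rewrite (_ : (fun t => u t ^+ 2) = u * u)//; apply: (@cvgM _ R); exact: cu.
    apply: (@cvgM _ R); first exact: cvg_cst.
    by apply: (@continuous_comp _ _ _ x (fun z => dblpow z al)); [exact: cx|exact: cdbl].
  move=> z z01; have d1 := is_derive_sqr _ _ _ (du z z01).
  have d2 := @is_derive1_comp _ _ x z _ _ (ddbl (x z)) (dx z z01).
  have d3 := is_deriveD d1 (is_deriveZ (v ^+ 2) d2).
  by apply: (is_derive_eq d3); rewrite /GRing.scale/=; ring.
pose sig := Num.sqrt e2.
have e20 : 0 <= e2.
  by apply: addr_ge0; [|apply: mulr_ge0; [|exact: dblpow_ge0]]; exact: sqr_ge0.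
have sig0 : 0 <= sig := sqrtr_ge0 _.
have sig2 : sig ^+ 2 = e2 by rewrite sqr_sqrtr.
have dg (t : R) : 0 < t < 1 -> is_derive t 1 g ((l t).1, v * dblpow (g t).1 al).
  move=> t01; rewrite lE ?W// gE ?W//=.
  have : is_derive t 1 (fun t => (x t, y t)) (u t, v * dblpow (x t) al).
    by apply/is_derive_pairP; split; [exact: dx|exact: dy].
  apply: near_eq_is_derive; case/andP: t01 => t0 t1; near=> z; rewrite gE//.
  apply/andP; split; near: z.
    by move/lt_nbhsr: t0; apply: filterS => z /ltW.
  by move/lt_nbhsl: t1; apply: filterS => z /ltW.
(* The speed is at least [sig] at all interior times, and its integral over unit time is the length
   [|c|]. *)
have sigc : sig <= `|c|.
  rewrite -lee_fin -lenE; have -> : sig = sig * 1 - sig * 0 by rewrite mulr1 mulr0 subr0.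
  apply: (@lipschitz_le_integral _ (fun t => sig * t) _ sig 1) => //.
  - by move=> a b _ _; rewrite -mulrBr normrM ger0_norm.
  - by move=> t; exact: sr_norm_ge0.
  - exists [set 0; 1]; split; first exact: measurableU.
      rewrite null_set_setU//; exact: lebesgue_measure_set1.
    move=> t /= H; apply: contrapT => t01; apply: H; rewrite in_itv/= => /andP[t0 t1].
    have {t0 t1} tt : 0 < t < 1.
      move: t0 t1; rewrite !le_eqVlt => /predU1P[t0|->] /predU1P[t1|->]//; exfalso; apply: t01.
      - by left.
      - by left.
      - by right.
    exists sig.
      have := is_deriveZ sig (is_derive_id t (1 : R)).
      by move=> H; apply: (is_derive_eq H); rewrite /GRing.scale/= mulr1.
    apply: extremal_speed_le (dg t tt) _.
    by rewrite lE ?W// gE ?W//= energy// W.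
have xM t : 0 <= t <= 1 -> `|x t| <= M.
  move=> /andP[]; rewrite le_eqVlt => /predU1P[<- _|t0 t1].
    by rewrite /x clamp_id ?lexx ?ler01// g0/=; apply: ltW.
  have := horizontal_fst_le al 1 t g _ hg; rewrite lenE lee_fin t0 t1 => /(_ isT).
  rewrite g0 gE/= ?t1 ?(ltW t0)// => hx.
  have := ler_normD (x t - x0) x0; rewrite subrK; lra.
pose s : R := Num.sg c.
have s2 : s ^+ 2 = 1 by rewrite /s sqr_sg c0.
have sc : s * c = `|c| by rewrite normrEsg.
pose S t := s * (w * y t + F (x t)).
pose D t := s * (w * (v * dblpow (x t) al) + n (x t) * u t).
have dFx (t : R) : 0 < t < 1 -> is_derive t 1 (F \o x) (n (x t) * u t).
  by move=> t01; apply: is_derive1_comp; [exact: dF|exact: dx].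
have dS (t : R) : 0 < t < 1 -> is_derive t 1 S (D t).
  move=> t01; have := is_deriveZ s (is_deriveD (is_deriveZ w (dy t t01)) (dFx t t01)).
  by [].
have cF : continuous F by move=> z; exact: is_derive1_continuous (dF z).
have cS : continuous S.
  move=> z; apply: (@cvgM _ R); first exact: cvg_cst.
  apply: cvgD; last by apply: continuous_comp; [exact: cx|exact: cF].
  by apply: (@cvgM _ R); [exact: cvg_cst|exact: cy].
have nP (t : R) : 0 <= t <= 1 -> n (x t) ^+ 2 + w ^+ 2 * dblpow (x t) al = 1.
  by move=> t01; rewrite nE pwE ?xM// subrK.
have Dsig t : 0 < t < 1 -> D t <= sig.
  move=> t01; rewrite /sig -(energy t (W _ t01)) -dblpow_norm -exprMn.
  rewrite /D -dblpow_norm; set r := `|x t| `^ al.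
  have -> : s * (w * (v * r ^+ 2) + n (x t) * u t) = (s * n (x t)) * u t + (s * w * r) * (v * r).
    by rewrite expr2; ring.
  apply: dot_le_sqrt; rewrite !exprMn s2 !mul1r /r dblpow_norm nP//; exact: W.
have x0E : x 0 = x0 by rewrite /x clamp_id ?lexx ?ler01// g0.
have y0E : y 0 = y0 by rewrite /y clamp_id ?lexx ?ler01// g0.
have x1E : x 1 = X by rewrite /x clamp_id ?lexx ?ler01// g1.
have y1E : y 1 = y0 + B X by rewrite /y clamp_id ?lexx ?ler01// g1.
have cid : continuous (fun t : R => sig * t).
  by move=> z; apply: (@cvgM _ R); [exact: cvg_cst|exact: cvg_id].
have dsig (t : R) : is_derive t 1 (fun t : R => sig * t) sig.
  have := is_deriveZ sig (is_derive_id t (1 : R)).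
  by move=> H; apply: (is_derive_eq H); rewrite /GRing.scale/= mulr1.
have S10 : S 1 - S 0 = `|c|.
  rewrite /S x1E y1E x0E y0E F0 -sc AE; ring.
(* The total increase [|c|], at least [sig], is accumulated in unit time at rate at most [sig], so
   no subinterval may fall short. *)
have Slin t : 0 <= t <= 1 -> S t - S 0 = sig * t.
  move=> /andP[t0 t1].
  have h1 : S t - S 0 <= sig * t - sig * 0.
    apply: (derive_le_slope S (fun t => sig * t) D (cst sig) 0 t t0 cS cid).
    - by move=> z /andP[z0 zt]; apply: dS; rewrite z0 (lt_le_trans zt).
    - by move=> z /andP[z0 zt]; apply: Dsig; rewrite z0 (lt_le_trans zt).
  have h2 : S 1 - S t <= sig * 1 - sig * t.
    apply: (derive_le_slope S (fun t => sig * t) D (cst sig) t 1 t1 cS cid).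
    - by move=> z /andP[z0 zt]; apply: dS; rewrite zt (le_lt_trans t0).
    - by move=> z /andP[z0 zt]; apply: Dsig; rewrite zt (le_lt_trans t0).
  lra.
have sigE : sig = `|c| by have := Slin 1; rewrite ler01 lexx => /(_ isT); lra.
have DE t : 0 < t < 1 -> D t = sig.
  move=> t01; apply: is_derive_unique (dS t t01) _.
  have := is_deriveD (is_derive_cst (S 0) t (1 : R)) (dsig t).
  rewrite add0r; apply: near_eq_is_derive; case/andP: t01 => t0 t1; near=> z.
  have -> : S z = S 0 + sig * z; last by [].
  rewrite -Slin; first by rewrite addrC subrK.
  apply/andP; split; near: z.
    by move/lt_nbhsr: t0; apply: filterS => z /ltW.
  by move/lt_nbhsl: t1; apply: filterS => z /ltW.
have eqs t : 0 < t < 1 -> u t = c * n (x t) /\ v * dblpow (x t) al = c * w * dblpow (x t) al.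
  move=> t01; have h1 := DE t t01; have h2 := energy t (W _ t01).
  have h3 := nP t (W _ t01); rewrite /D -sig2 in h1 h2.
  set p := dblpow (x t) al in h1 h2 h3 *; set nx := n (x t) in h1 h3 *.
  have p0 : 0 <= p := dblpow_ge0 _ _.
  have cE : c = s * sig by rewrite sigE -sc mulrA -expr2 s2 mul1r.
  (* The equality case of Cauchy-Schwarz, as a vanishing sum of nonnegative terms. Where [p = 0] it
     leaves [v] free, hence a conclusion about the products with [p], which is all that the equation
     for [y] involves. *)
  have E : (u t - c * nx) ^+ 2 + p * (v - c * w) ^+ 2 = 0.
    have -> : (u t - c * nx) ^+ 2 + p * (v - c * w) ^+ 2 =
      (u t ^+ 2 + v ^+ 2 * p) - 2 * sig * (s * (w * (v * p) + nx * u t)) +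
      sig ^+ 2 * s ^+ 2 * (nx ^+ 2 + w ^+ 2 * p) by rewrite cE; ring.
    by rewrite h1 h2 h3 s2; ring.
  have [E1 E2] : (u t - c * nx) ^+ 2 = 0 /\ p * (v - c * w) ^+ 2 = 0.
    have := sqr_ge0 (u t - c * nx); have : 0 <= p * (v - c * w) ^+ 2.
      by rewrite mulr_ge0// sqr_ge0.
    by move=> q1 q2; split; apply/eqP; rewrite eq_le ?q1 ?q2 andbT -E ?lerDl ?lerDr.
  split; first by apply/eqP; rewrite -subr_eq0 -sqrf_eq0 E1.
  move/eqP: E2; rewrite mulf_eq0 sqrf_eq0 subr_eq0 => /orP[|] /eqP ->//.
  by rewrite !mulr0.
have cA : continuous A by move=> z; exact: is_derive1_continuous (dA z).
have cB : continuous B by move=> z; exact: is_derive1_continuous (dB z).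
(* From [x' = c n(x)] the arc length [A x] grows at the constant rate [c], which determines [x];
   then [y - B x] is constant. *)
have Ax t : 0 <= t <= 1 -> A (x t) = t * c.
  move=> t01.
  have := derive0_cst (fun t => A (x t) - t * c) 0 1 _ _ t t01.
  rewrite x0E A0 mul0r subr0 => H; apply/eqP; rewrite -subr_eq0; apply/eqP; apply: H.
    move=> z; apply: cvgB; first by apply: continuous_comp; [exact: cx|exact: cA].
    by apply: (@cvgM _ R); [exact: cvg_id|exact: cvg_cst].
  move=> z z01; have d1 := @is_derive1_comp _ A x z _ _ (dA (x z)) (dx z z01).
  have d2 := is_deriveB d1 (is_deriveM (is_derive_id z (1 : R)) (is_derive_cst c z (1 : R))).
  apply: (is_derive_eq d2); rewrite /GRing.scale/= (eqs z z01).1.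
  have n0 : n (x z) != 0 by rewrite gt_eqF// nn_gt0.
  by rewrite mulr0 add0r mulr1 mulrCA mulVf// mulr1 subrr.
have xE t : 0 <= t <= 1 -> x t = arc_x t by move=> t01; rewrite /arc_x -Ax// AK.
move=> t t01; rewrite gE// /arc_curve -xE//; congr (_, _).
suff <- : y t - B (x t) = y0 by rewrite subrK.
apply: (etrans (derive0_cst (fun t => y t - B (x t)) 0 1 _ _ t t01)); [|move=> z z01|by rewrite x0E B0 y0E subr0].
  by move=> z; apply: cvgB; [exact: cy|apply: continuous_comp; [exact: cx|exact: cB]].
have d1 := @is_derive1_comp _ B x z _ _ (dB (x z)) (dx z z01).
have d2 := is_deriveB (dy z z01) d1.
apply: (is_derive_eq d2); have [-> ->] := eqs z z01.
have n0 : n (x z) != 0 by rewrite gt_eqF// nn_gt0.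
rewrite pwE ?xM ?W//; field.
exact: n0.
Unshelve. all: by end_near. Qed.

End arc_geodesics.

(** * Areas under fibered bi-Lipschitz maps *)

(** Lebesgue measure is the outer measure generated by half-open intervals, and [f] carries []a, b]]
    onto []f a, f b]], of length at most [M (b - a)]. The image by [f] is written as a preimage by
    its inverse, for which measurability is immediate. *)
Lemma lebesgue_bilipschitz_image {R : realType} (m M : R) (f h : R -> R)
    (D : set (measurableTypeR R)) :
  0 < m -> bilipschitz m M f -> cancel f h -> cancel h f ->
  measurable_fun setT (h : measurableTypeR R -> measurableTypeR R) ->
  measurable D ->
  (lebesgue_measure (h @^-1` D) <= M%:E * lebesgue_measure D)%E.
Proof.
move=> m0 fmM fh hf mh mD.
have M0 : 0 < M.
  have /andP[h1 h2] := fmM 0 1 ler01; move: (le_trans h1 h2).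
  by rewrite subr0 !mulr1; apply: lt_le_trans.
have fle := bilipschitz_le _ _ _ m0 fmM.
rewrite muleC -lee_pdivrMr// [leRHS](_ : _ = (wlength idfun)^*%mu D)//.
apply: le_ereal_inf_tmp => _ [F [mF DF] <-]; rewrite lee_pdivrMr// muleC.
have mF' k : measurable (F k : set (measurableTypeR R)).
  by have := mF k; exact: sub_sigma_algebra.
have mhF k : measurable (h @^-1` (F k) : set (measurableTypeR R)).
  by rewrite -[X in measurable X]setTI; exact: mh.
have mhD : measurable (h @^-1` D : set (measurableTypeR R)).
  by rewrite -[X in measurable X]setTI; exact: mh.
have hDF : h @^-1` D `<=` \bigcup_k (h @^-1` (F k)).
  by move=> x /DF[k _ Fk]; exists k.
apply: le_trans (measure_sigma_subadditive _ mhF mhD hDF) _.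
rewrite -(nneseriesZl M 0) => [|k _]; last exact: wlength_ge0.
apply: lee_nneseries => [k _ _|k _]; first exact: measure_ge0.
have [[a b] _ <-] := mF k; rewrite /=.
have -> : h @^-1` `]a, b]%classic = `]f a, f b]%classic.
  have E z : (a < h z <= b) = (f a < z <= f b).
    by rewrite !ltNge -[h z <= a]fle -[h z <= b]fle hf.
  by apply/seteqP; split => z /=; rewrite !in_itv/= E.
rewrite lebesgue_measure_itv wlength_itv /= !lte_fin.
have [fab|_] := ltP (f a) (f b); last first.
  by apply: mule_ge0; [rewrite lee_fin ltW|case: ifPn => // ab; rewrite -EFinB lee_fin subr_ge0 ltW].
have ab : a < b by rewrite ltNge -fle -ltNge.
by rewrite ab -!EFinB -EFinM lee_fin; have /andP[] := fmM a b (ltW ab).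
Qed.

(** [h x y < c] is equivalent to [y < f x c], so joint measurability of the inverse only takes
    measurability of [f] in its first variable. *)
Lemma measurable_fiber_inverse {R : realType} (m M : R) (f h : R -> R -> R) :
  0 < m -> (forall x, bilipschitz m M (f x)) ->
  (forall x, cancel (h x) (f x)) ->
  (forall y, measurable_fun setT ((fun x => f x y) : measurableTypeR R -> measurableTypeR R)) ->
  measurable_fun setT ((fun z => h z.1 z.2) :
     measurableTypeR R * measurableTypeR R -> measurableTypeR R).
Proof.
move=> m0 fmM hf mf.
have fle x := bilipschitz_le _ _ _ m0 (fmM x).
move=> mT; apply: (measurability _ (RGenInftyO.measurableE R)) => //.
move=> _ [_ [c ->] <-]; rewrite setTI.
have -> : (fun z : R * R => h z.1 z.2) @^-1` `]-oo, c[ =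
    (fun z : measurableTypeR R * measurableTypeR R => z.2 < f z.1 c) @^-1` [set true].
  have E x y : (h x y < c) = (y < f x c) by rewrite !ltNge -[c <= h x y](fle x) hf.
  by apply/seteqP; split => -[x y] /=; rewrite in_itv/= E.
rewrite -[X in measurable X]setTI; apply: measurable_fun_ltr => //.
exact: (measurableT_comp (mf c) measurable_fst).
Qed.

(** [D] is arbitrary, so the estimate is made on measurable covers: the preimages by the inverse map
    [Psi] of the sets covering [D] cover its image, and each of them is measured section by
    section. *)
Lemma leb2_fiber_image_le {R : realType} (m M : R) (f h : R -> R -> R)
    (D : set (R * R)) :
  0 < m -> (forall x, bilipschitz m M (f x)) ->
  (forall x, cancel (f x) (h x)) -> (forall x, cancel (h x) (f x)) ->
  (forall y, measurable_fun setT ((fun x => f x y) : measurableTypeR R -> measurableTypeR R)) ->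
  (leb2 ((fun z => (z.1, f z.1 z.2)) @` D) <= M%:E * leb2 D)%E.
Proof.
move=> m0 fmM fh hf mf.
have mh := measurable_fiber_inverse _ _ _ _ m0 fmM hf mf.
have M0 : 0 < M.
  have /andP[h1 h2] := fmM 0 0 1 ler01; move: (le_trans h1 h2).
  by rewrite subr0 !mulr1; apply: lt_le_trans.
pose Psi : measurableTypeR R * measurableTypeR R -> measurableTypeR R * measurableTypeR R :=
  fun z => (z.1, h z.1 z.2).
have mPsi : measurable_fun setT Psi by apply: measurable_fun_pair.
pose mu2 : set (measurableTypeR R * measurableTypeR R) -> \bar R :=
  (@lebesgue_measure R \x @lebesgue_measure R)%E.
have mu2_le (E : set (measurableTypeR R * measurableTypeR R)) : measurable E ->
    (mu2 (Psi @^-1` E) <= M%:E * mu2 E)%E.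
  move=> mE; rewrite /mu2 /product_measure1 -ge0_integralZl//; last 2 first.
    exact: measurable_fun_xsection.
    by rewrite lee_fin ltW.
  apply: ge0_le_integral_all => x _ /=; first exact: measure_ge0.
  have -> : xsection (Psi @^-1` E) x = h x @^-1` (xsection E x).
    by apply/seteqP; split => y; rewrite /xsection/= !inE.
  apply: (lebesgue_bilipschitz_image m M (f x)) => //.
    exact: (measurableT_comp mh (measurable_pair1 x)).
  exact: measurable_xsection.
rewrite muleC -lee_pdivrMr//.
apply: le_ereal_inf_tmp => _ [F [mF DF] <-]; rewrite lee_pdivrMr// muleC.
rewrite -(nneseriesZl M 0) => [|k _]; last exact: measure_ge0.
have mPF k : measurable (Psi @^-1` (F k)).
  by rewrite -[X in measurable X]setTI; exact: mPsi.
apply: (@le_trans _ _ (\sum_(0 <= k <oo) mu2 (Psi @^-1` (F k)))%E).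
  apply: ereal_inf_lbound; exists (fun k => Psi @^-1` (F k)) => //.
  split => // _ [z /DF[k _ Fk] <-]; exists k => //.
  by rewrite /Psi/= fh -surjective_pairing.
apply: lee_nneseries => [k _ _|k _]; first exact: measure_ge0.
exact: mu2_le.
Qed.

(** The swapped product measure agrees with the product measure on rectangles, hence everywhere;
    covers carry this over to arbitrary sets. *)
Lemma leb2_swap_le {R : realType} (D : set (R * R)) :
  (leb2 ((fun z => (z.2, z.1)) @` D) <= leb2 D)%E.
Proof.
pose T := measurableTypeR R.
pose mu2 : {measure set (T * T) -> \bar R} := (@lebesgue_measure R \x @lebesgue_measure R)%E.
pose sw (z : T * T) : T * T := (z.2, z.1).
have ms : measurable_fun setT sw by apply: measurable_fun_pair.
have E (A : set (T * T)) : measurable A -> mu2 (sw @^-1` A) = mu2 A.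
  move=> mA; apply/esym.
  apply: (@product_measure_unique _ _ T T R lebesgue_measure lebesgue_measure
    (pushforward mu2 sw)) => // B C mB mC.
  apply: (@etrans _ _ (mu2 (C `*` B))).
    by congr (mu2 _); apply/seteqP; split => -[x y] [].
  by rewrite /mu2/= product_measure1E// muleC.
apply: le_ereal_inf_tmp => _ [F [mF DF] <-].
have mPF k : measurable (sw @^-1` (F k)).
  by rewrite -[X in measurable X]setTI; exact: ms.
apply: (@le_trans _ _ (\sum_(0 <= k <oo) mu2 (sw @^-1` (F k)))%E).
  apply: ereal_inf_lbound; exists (fun k => sw @^-1` (F k)) => //.
  by split => // _ [[x y] /DF[k _ Fk] <-]; exists k.
by apply: lee_nneseries => [k _ _|k _]; [exact: measure_ge0|rewrite E].
Qed.

Lemma leb2_swap {R : realType} (D : set (R * R)) :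
  leb2 ((fun z => (z.2, z.1)) @` D) = leb2 D.
Proof.
apply/eqP; rewrite eq_le leb2_swap_le/=.
apply: le_trans (leb2_swap_le _); rewrite image_comp.
by rewrite (_ : _ @` D = D)//; apply/seteqP; split=> [z [[x y] Dz <-]//|[x y] Dz]; exists (x, y).
Qed.

(** The lower bound is the upper bound for the fiberwise inverse, whose slopes lie between [1 / M]
    and [1 / m]. *)
Lemma leb2_fiber_bilipschitz {R : realType} (m M : R) (f : R -> R -> R) (D : set (R * R)) :
  0 < m -> (forall x, bilipschitz m M (f x)) ->
  (forall y, measurable_fun setT ((fun x => f x y) : measurableTypeR R -> measurableTypeR R)) ->
  (m%:E * leb2 D <= leb2 ((fun z => (z.1, f z.1 z.2)) @` D) <= M%:E * leb2 D)%E.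
Proof.
move=> m0 fmM mf.
have [h hh] := choice (fun x => bilipschitz_inverse m M (f x) m0 (fmM x)).
have fh x : cancel (f x) (h x) by have [] := hh x.
have hf x : cancel (h x) (f x) by have [] := hh x.
have hmM x : bilipschitz M^-1 m^-1 (h x) by have [] := hh x.
have M0 : 0 < M.
  have /andP[h1 h2] := fmM 0 0 1 ler01; move: (le_trans h1 h2).
  by rewrite subr0 !mulr1; apply: lt_le_trans.
apply/andP; split; last exact: leb2_fiber_image_le m0 fmM fh hf mf.
have mh := measurable_fiber_inverse _ _ _ _ m0 fmM hf mf.
have mhy y : measurable_fun setT ((fun x => h x y) : measurableTypeR R -> measurableTypeR R).
  exact: (measurableT_comp mh (measurable_pair2 y)).
have Mi : 0 < M^-1 by rewrite invr_gt0.
have := leb2_fiber_image_le _ _ _ _ ((fun z => (z.1, f z.1 z.2)) @` D) Mi hmM hf fh mhy.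
rewrite image_comp (_ : _ @` D = D); last first.
  apply/seteqP; split=> [z [[x y] Dz <-]/=|[x y] Dz]; first by rewrite fh.
  by exists (x, y) => //=; rewrite fh.
by rewrite -lee_pdivlMl ?invr_gt0// invrK.
Qed.

Lemma leb2_fiber_bilipschitz_fst {R : realType} (m M : R) (f : R -> R -> R) (D : set (R * R)) :
  0 < m -> (forall y, bilipschitz m M (f^~ y)) ->
  (forall x, measurable_fun setT (f x : measurableTypeR R -> measurableTypeR R)) ->
  (m%:E * leb2 D <= leb2 ((fun z => (f z.1 z.2, z.2)) @` D) <= M%:E * leb2 D)%E.
Proof.
move=> m0 fmM mf.
have := leb2_fiber_bilipschitz m M (fun y x => f x y) ((fun z => (z.2, z.1)) @` D) m0 fmM mf.
rewrite leb2_swap -[leb2 ((fun z => (z.1, _)) @` _)]leb2_swap.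
rewrite image_comp image_comp.
by rewrite (_ : (_ \o _ \o _) = (fun z => (f z.1 z.2, z.2))).
Qed.

(** * Dependence of the quadratures on the covector *)

Section width_dependence.
Context {R : realType} (al M x0 om k : R).
Context (al1 : 1 <= al) (M0 : 0 < M) (om0 : 0 <= om) (k0 : 0 < k)
  (omM : k ^- 2 <= 1 - om ^+ 2 * dblpow M al).

Lemma width_small (w : R) : `|w| <= om -> w ^+ 2 * dblpow M al < 1.
Proof.
move=> wom; have k2 : 0 < k ^- 2 by rewrite invr_gt0 exprn_gt0.
have : w ^+ 2 * dblpow M al <= om ^+ 2 * dblpow M al.
  apply: ler_wpM2r; first exact: dblpow_ge0.
  by rewrite -real_normK ?num_real// lerXn2r// nnegrE.
by move=> /le_lt_trans; apply; rewrite -subr_gt0; exact: lt_le_trans omM.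
Qed.

Let wM := width_small.

Lemma nnV_width_le (w x : R) : `|w| <= om -> 0 < (nn al M w x)^-1 <= k.
Proof.
move=> wom; have n0 := nn_gt0 al M w al1 M0 (wM w wom) x.
rewrite invr_gt0 n0/= -[leRHS]invrK lef_pV2 ?posrE ?invr_gt0//.
rewrite -(@ler_pXn2r _ 2)// ?nnegrE ?invr_ge0 ?(ltW n0) ?(ltW k0)//.
rewrite (nn_sqr al M w al1 M0 (wM w wom)) exprVn; apply: le_trans omM _.
rewrite lerD2l lerN2; apply: ler_pM; rewrite ?sqr_ge0 ?pw_ge0 ?pw_le//.
by rewrite -real_normK ?num_real// lerXn2r// nnegrE.
Qed.

Lemma is_derive_nnV_width (x w : R) : `|w| <= om ->
  is_derive w 1 (fun w => (nn al M w x)^-1) (w * pw al M x / nn al M w x ^+ 3).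
Proof.
move=> wom; have n2 := one_sub_pw_gt0 al M w al1 M0 (wM w wom) x.
have n0 : nn al M w x != 0 by rewrite gt_eqF// nn_gt0// wM.
have d1 : is_derive w 1 (cst 1 - pw al M x \*: (fun w => id w ^+ 2))
    (0 - pw al M x * (2 * w * 1)).
  by apply: is_deriveB; apply: is_deriveZ; exact: is_derive_sqr.
have e1 : (cst 1 - pw al M x \*: (fun w => id w ^+ 2)) w = 1 - w ^+ 2 * pw al M x.
  by rewrite [in RHS]mulrC.
have n2' : 0 < (cst 1 - pw al M x \*: (fun w => id w ^+ 2)) w by rewrite e1.
have d2 := @is_derive1_comp _ Num.sqrt _ w _ _ (is_derive1_sqrt n2') d1.
have e2 : Num.sqrt \o (cst 1 - pw al M x \*: (fun w => id w ^+ 2)) = (fun w => nn al M w x).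
  by apply/funext => z; rewrite /nn/= [in RHS]mulrC.
rewrite e2 e1 in d2.
have d3 := @is_deriveV _ (fun w => nn al M w x) _ _ _ n0 d2.
apply: (is_derive_eq d3); rewrite /GRing.scale/=.
have -> : Num.sqrt (1 - w ^+ 2 * pw al M x) = nn al M w x by [].
by field.
Qed.

(** By [n^2 + w^2 p = 1] the two terms of the derivative collapse to [p / n^3]. With
    [1 <= 1 / n <= k] the slopes lie between [p] and [k^3 p], the origin of the cubes in later
    bounds. *)
Lemma is_derive_height_width (x w : R) : `|w| <= om ->
  is_derive w 1 (fun w => w * pw al M x / nn al M w x) (pw al M x / nn al M w x ^+ 3).
Proof.
move=> wom.
have n0 : nn al M w x != 0 by rewrite gt_eqF// nn_gt0// wM.
have n2 := nn_sqr al M w al1 M0 (wM w wom) x.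
have d := is_deriveM (is_deriveZ (pw al M x) (is_derive_id w (1 : R))) (is_derive_nnV_width x w wom).
have e : (pw al M x \*: id) * (fun w => (nn al M w x)^-1) = (fun w => w * pw al M x / nn al M w x).
  by apply/funext => z; rewrite [in RHS](mulrC z).
rewrite e in d; apply: (is_derive_eq d); rewrite /GRing.scale/=.
transitivity (pw al M x * (nn al M w x ^+ 2 + w ^+ 2 * pw al M x) / nn al M w x ^+ 3); last first.
  by rewrite n2 subrK mulr1.
by rewrite /= /GRing.scale/=; field.
Qed.

Lemma height_width_slope (x w w' : R) : `|w| <= om -> `|w'| <= om -> w <= w' ->
  pw al M x * (w' - w) <= w' * pw al M x / nn al M w' x - w * pw al M x / nn al M w x
    <= k ^+ 3 * pw al M x * (w' - w).
Proof.
move=> wom wom' ww'.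
have zom (z : R) : z \in `[w, w'] -> `|z| <= om.
  rewrite in_itv/= => /andP[wz zw]; move: wom wom'; rewrite !ler_norml => /andP[h1 h2] /andP[h3 h4].
  by apply/andP; split; lra.
have [z zi|c ci ->] := MVT_segment ww' (fun z (zi : z \in `]w, w'[) =>
   is_derive_height_width x z (zom z (subset_itv_oo_cc zi))).
  apply: derivable_within_continuous => z' zi'; by have [] := is_derive_height_width x z' (zom z' zi').
have /andP[v0 vk] := nnV_width_le c x (zom c ci).
have p0 := pw_ge0 al M x.
have n1 : 1 <= (nn al M c x)^-1.
  by rewrite invf_ge1 ?nn_le1 ?nn_gt0// wM// zom.
rewrite -exprVn; apply/andP; split; apply: ler_wpM2r; rewrite ?subr_ge0//.
  by rewrite ler_peMr// exprn_ege1.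
by rewrite mulrC ler_wpM2r// lerXn2r// nnegrE ltW.
Qed.

(** The primitive of [x^(2 al)] vanishing at 0. The stated quotient is one of its increments, the
    factor [2 al + 1] cancelling. *)
Definition dblpow_primitive (x : R) := dblpow x al * x / (2 * al + 1).
Local Notation G := dblpow_primitive.

(** Functions of [x] with ordered derivatives have ordered increments, so the bound in [w] for the
    integrand passes to its primitive without differentiation under the integral sign. *)
Lemma arcB_width_slope (w w' X X' : R) : `|w| <= om -> `|w'| <= om -> w <= w' ->
  - M <= X -> X <= X' -> X' <= M ->
  (w' - w) * (G X' - G X) <=
    (arcB al M x0 w' X' - arcB al M x0 w X') - (arcB al M x0 w' X - arcB al M x0 w X)
    <= k ^+ 3 * (w' - w) * (G X' - G X).
Proof.
move=> wom wom' ww' MX XX XM.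
pose D x := arcB al M x0 w' x - arcB al M x0 w x; rewrite -/(D X) -/(D X').
have dD (x : R) : is_derive x 1 D (w' * pw al M x / nn al M w' x - w * pw al M x / nn al M w x).
  by apply: is_deriveB; apply: is_derive_arcB; rewrite ?wM.
have dG (x c : R) : is_derive x 1 (c \*: G) (c * dblpow x al).
  by apply: is_deriveZ; exact: is_derive_dblpow_primitive.
have cD : continuous D by move=> z; exact: is_derive1_continuous (dD z).
have cG c : continuous (c \*: G) by move=> z; exact: is_derive1_continuous (dG z c).
have xM x : X < x < X' -> `|x| <= M.
  by move=> /andP[h1 h2]; rewrite ler_norml; apply/andP; split; lra.
rewrite (mulrBr (w' - w)) (mulrBr (k ^+ 3 * (w' - w))); apply/andP; split.
  apply: (derive_le_slope ((w' - w) \*: G) D _ _ X X' XX (cG _) cD (fun x _ => dG x _) (fun x _ => dD x)).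
  move=> x xX; have /andP[+ _] := height_width_slope x w w' wom wom' ww'.
  by rewrite (pwE al M x (xM x xX)) mulrC.
apply: (derive_le_slope D ((k ^+ 3 * (w' - w)) \*: G) _ _ X X' XX cD (cG _) (fun x _ => dD x) (fun x _ => dG x _)).
move=> x xX; have /andP[_] := height_width_slope x w w' wom wom' ww'.
by rewrite (pwE al M x (xM x xX)) (mulrAC (k ^+ 3)).
Qed.

(** This serves the continuity of the time map in [w], for which the crude bound
    [|w p / n^3| <= om M^(2 al) k^3] suffices. *)
Lemma arcA_width_lipschitz (w w' X : R) : `|w| <= om -> `|w'| <= om ->
  `|arcA al M x0 w X - arcA al M x0 w' X| <= om * dblpow M al * k ^+ 3 * `|w - w'| * `|X - x0|.
Proof.
move=> wom wom'; pose D x := arcA al M x0 w x - arcA al M x0 w' x.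
have dD (x : R) : is_derive x 1 D ((nn al M w x)^-1 - (nn al M w' x)^-1).
  by apply: is_deriveB; apply: is_derive_arcA; rewrite ?wM.
have D0 : D x0 = 0 by rewrite /D !arcA0 ?wM// subrr.
rewrite -/(D X) -[D X]subr0 -D0; apply: derive_norm_le dD _ _ _ => x.
clear D D0; wlog ww' : w w' wom wom' / w <= w' => [H|].
  by case: (leP w w') => [|/ltW] ww'; [|rewrite distrC (distrC w)]; exact: H.
have zom (z : R) : z \in `[w, w'] -> `|z| <= om.
  rewrite in_itv/= => /andP[wz zw]; move: wom wom'; rewrite !ler_norml => /andP[h1 h2] /andP[h3 h4].
  by apply/andP; split; lra.
rewrite distrC.
have [z zi|c ci ->] := MVT_segment ww' (fun z (zi : z \in `]w, w'[) =>
   is_derive_nnV_width x z (zom z (subset_itv_oo_cc zi))).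
  apply: derivable_within_continuous => z' zi'; by have [] := is_derive_nnV_width x z' (zom z' zi').
have /andP[v0 vk] := nnV_width_le c x (zom c ci).
rewrite normrM (distrC w); apply: ler_wpM2r => //.
rewrite -exprVn normrM (normrM c) normrX (ger0_norm (ltW v0)) (ger0_norm (pw_ge0 _ _ _)).
apply: ler_pM; rewrite ?mulr_ge0 ?pw_ge0 ?exprn_ge0 ?(ltW v0)//.
  by apply: ler_pM; rewrite ?pw_ge0 ?zom ?pw_le.
by rewrite lerXn2r// nnegrE ltW.
Qed.

End width_dependence.

(** Area comparison wants slopes bounded below on whole fibers, whereas the height is controlled in
    a box only. Both variables are clamped to the box, and the term [lo * (w - cw w)] restores the
    slope that clamping the width would flatten. To the left of [c] the height decreases in the
    width; the sign [s] makes it increase. *)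
Lemma height_fiber_map {R : realType} (al M c y0 om k z d s lo hi : R) :
  1 <= al -> 0 < M -> 0 <= om -> 1 <= k -> k ^- 2 <= 1 - om ^+ 2 * dblpow M al ->
  0 <= d -> (forall X, `|X - z| <= d -> `|X| <= M) -> `|c| <= M ->
  s = 1 /\ c <= z - d \/ s = -1 /\ z + d <= c ->
  0 <= lo ->
  (forall X, `|X - z| <= d ->
     lo <= s * (dblpow_primitive al X - dblpow_primitive al c) <= hi) ->
  exists f : R -> R -> R, [/\ forall X, bilipschitz lo (k ^+ 3 * hi) (f X),
    forall w, continuous (f^~ w) &
    forall X w, `|X - z| <= d -> `|w| <= om -> f X w = y0 + arcB al M c (s * w) X].
Proof.
move=> al1 M0 om0 k1 omM d0 zM cM sE lo0 GE.
have k0 : 0 < k by apply: lt_le_trans k1.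
have wM := width_small al M om k om0 k0 omM.
pose cw w := clamp (- om) om w; pose cX X := clamp (z - d) (z + d) X.
have cwom w : `|cw w| <= om by exact: clamp_norm.
have cXz X : z - d <= cX X <= z + d by apply: clamp_itv; lra.
have cXd X : `|cX X - z| <= d.
  by rewrite ler_norml; have /andP[h1 h2] := cXz X; apply/andP; split; lra.
have s1 : `|s| = 1 by case: sE => -[-> _]; rewrite ?normrN normr1.
have swom w : `|s * cw w| <= om by rewrite normrM s1 mul1r.
exists (fun X w => y0 + arcB al M c (s * cw w) (cX X) + lo * (w - cw w)); split.
- move=> X w w' ww'; have /andP[cw0 cw1] := clamp_mono (- om) om w w' ww'.
  have /andP[l1 l2] := GE _ (cXd X); rewrite -/(cw w) -/(cw w') in cw0 cw1.
  have /andP[z1 z2] := cXz X; set x := cX X in l1 l2 z1 z2 *.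
  have xM : `|x| <= M by apply: zM; exact: cXd.
  have hk : 1 <= k ^+ 3 by rewrite exprn_ege1.
  have hi0 : 0 <= hi by apply: le_trans lo0 (le_trans l1 l2).
  suff : lo * (cw w' - cw w) <= arcB al M c (s * cw w') x - arcB al M c (s * cw w) x
      <= k ^+ 3 * hi * (cw w' - cw w).
    move=> /andP[h1 h2]; have h3 : lo * (w' - w - (cw w' - cw w)) <= k ^+ 3 * hi * (w' - w - (cw w' - cw w)).
      apply: ler_wpM2r; first lra.
      by apply: (le_trans (le_trans l1 l2)); rewrite ler_peMl.
    by apply/andP; split; nra.
  have cwle (a b : R) : 0 <= b - a -> a <= b by rewrite subr_ge0.
  have bnd1 (D : R) : lo <= D -> lo * (cw w' - cw w) <= (cw w' - cw w) * D.
    by move=> lD; rewrite mulrC ler_wpM2l.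
  have bnd2 (D : R) : D <= hi -> k ^+ 3 * (cw w' - cw w) * D <= k ^+ 3 * hi * (cw w' - cw w).
    by move=> lD; rewrite mulrAC ler_wpM2r// ler_wpM2l// (le_trans _ hk).
  move: xM cM; rewrite !ler_norml => /andP[xM1 xM2] /andP[cM1 cM2].
  case: sE => -[sE zc]; rewrite sE ?mul1r ?mulN1r in l1 l2 *.
    have := arcB_width_slope al M c om k al1 M0 om0 k0 omM (cw w) (cw w') c x
      (cwom _) (cwom _) (cwle _ _ cw0) cM1 (le_trans zc z1) xM2.
    rewrite !arcB0 ?wM ?cwom// subrr subr0 => /andP[h1 h2].
    by apply/andP; split; [apply: le_trans h1|apply: (le_trans h2)]; (exact: bnd1 || exact: bnd2).
  (* The box lies to the left of [c]: the estimate is used on [[x, c]], with the opposite widths,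
     whose order is reversed. *)
  have := arcB_width_slope al M c om k al1 M0 om0 k0 omM (- cw w') (- cw w) x c
    _ _ _ xM1 (le_trans z2 zc) cM2.
  rewrite !normrN !cwom lerN2 (cwle _ _ cw0) => /(_ isT isT isT).
  rewrite !arcB0 ?wM ?normrN ?cwom// subrr sub0r opprB opprK (addrC (- cw w)).
  have -> : dblpow_primitive al c - dblpow_primitive al x =
    - (dblpow_primitive al x - dblpow_primitive al c) by rewrite opprB.
  move=> /andP[h1 h2].
  by apply/andP; split; [apply: le_trans h1|apply: (le_trans h2)]; (exact: bnd1 || exact: bnd2).
- move=> w z'; apply: cvgD; last exact: cvg_cst.
  apply: cvgD; first exact: cvg_cst.
  apply: (@continuous_comp _ _ _ cX (arcB al M c (s * cw w))); first exact: continuous_clamp.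
  by apply: is_derive1_continuous (is_derive_arcB al M c _ al1 M0 _ _); apply: wM.
- move=> X w Xz wom; move: wom; rewrite ler_norml => wom.
  rewrite /cw clamp_id// /cX clamp_id ?subrr ?mulr0 ?addr0//.
  by move: Xz; rewrite ler_norml => /andP[h1 h2]; apply/andP; split; lra.
Qed.

(** The map takes an abscissa to the one at the fraction [t] of the arc length, through the inverse
    of [A]. The slopes of [A] lie in [[1, k]] and those of its inverse in [[1 / k, 1]]. *)
Lemma time_fiber_map {R : realType} (al M c om k s t : R) :
  1 <= al -> 0 < M -> 0 <= om -> 0 < k -> k ^- 2 <= 1 - om ^+ 2 * dblpow M al ->
  `|s| = 1 -> 0 < t ->
  exists f : R -> R -> R, [/\ forall w, bilipschitz (t / k) (t * k) (f^~ w),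
    forall X, continuous (f X) &
    forall X w, `|w| <= om -> arcA al M c (s * w) (f X w) = t * arcA al M c (s * w) X].
Proof.
move=> al1 M0 om0 k0 omM s1 t0.
have wM := width_small al M om k om0 k0 omM.
pose cw w := s * clamp (- om) om w.
have cwom w : `|cw w| <= om by rewrite normrM s1 mul1r; exact: clamp_norm.
pose A w := arcA al M c (cw w).
have wk w : k ^- 2 <= 1 - cw w ^+ 2 * dblpow M al.
  apply: le_trans omM _; rewrite lerD2l lerN2; apply: ler_wpM2r; first exact: dblpow_ge0.
  by rewrite -real_normK ?num_real// lerXn2r// nnegrE.
have Ak w : bilipschitz 1 k (A w) by apply: arcA_bilipschitz => //; exact: wM.
have [h hh] := choice (fun w => bilipschitz_inverse 1 k (A w) ltr01 (Ak w)).
have hK w : cancel (h w) (A w) by have [] := hh w.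
have hk w : bilipschitz k^-1 1 (h w) by have [_ _] := hh w; rewrite invr1.
exists (fun X w => h w (t * A w X)); split.
- move=> w X X' XX.
  have /andP[a1 a2] := Ak w _ _ XX.
  have tA : t * A w X <= t * A w X'.
    by rewrite ler_pM2l// (bilipschitz_le _ _ _ ltr01 (Ak w)).
  have /andP[h1 h2] := hk w _ _ tA; rewrite -mulrBr mul1r in h1 h2.
  apply/andP; split.
    apply: le_trans h1; rewrite mulrAC mulrC ler_wpM2l ?invr_ge0 ?(ltW k0)//.
    by rewrite ler_pM2l//; move: a1; rewrite mul1r.
  by apply: (le_trans h2); rewrite -mulrA ler_pM2l.
- move=> X w0; set C0 := om * dblpow M al * k ^+ 3.
  have C00 : 0 <= C0 by rewrite !mulr_ge0 ?dblpow_ge0 ?exprn_ge0 ?(ltW k0).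
  have Aw w X' : `|A w0 X' - A w X'| <= C0 * `|w0 - w| * `|X' - c|.
    apply: (le_trans (arcA_width_lipschitz al M c om k al1 M0 om0 k0 omM _ _ _ (cwom w0) (cwom w))).
    apply: ler_wpM2r => //; apply: ler_wpM2l => //.
    by rewrite -mulrBr normrM s1 mul1r; exact: clamp_lipschitz.
  set g := fun w => _; have gE w : g w = h w (t * A w X) by [].
  apply: (@lipschitz_at_continuous _ g w0 (C0 * (t * `|X - c| + `|g w0 - c|))) => w.
  (* Inverses for different widths are compared through [A]: its slopes are at least 1, and
     [A w (g w) = t * A w X] at each width. *)
  have := bilipschitz_ge _ _ _ (g w0) (g w) ler01 (Ak w); rewrite mul1r => /le_trans; apply.
  have -> : A w (g w0) - A w (g w) = - (A w0 (g w0) - A w (g w0)) + t * (A w0 X - A w X).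
    by rewrite !gE !hK; ring.
  apply: (le_trans (ler_normD _ _)); rewrite normrN normrM (gtr0_norm t0).
  have h1 := Aw w (g w0); have h2 := Aw w X.
  have h3 : t * `|A w0 X - A w X| <= t * (C0 * `|w0 - w| * `|X - c|) by rewrite ler_pM2l.
  lra.
- move=> X w; rewrite ler_norml => wom.
  by have := hK w (t * A w X); rewrite /A /cw clamp_id.
Qed.

(** The derivative vanishes at the origin, so strictness is drawn from the odd function
    [x^(2 al) x], strictly increasing on the nonnegative half-line. *)
Lemma dblpow_primitive_lt {R : realType} (al x y : R) : 1 <= al -> x < y ->
  dblpow_primitive al x < dblpow_primitive al y.
Proof.
move=> al1 xy; rewrite /dblpow_primitive ltr_pM2r ?invr_gt0; last lra.
have al0 : 0 <= al by exact: le_trans al1.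
have pos (z : R) : z != 0 -> 0 < dblpow z al.
  by move=> z0; rewrite /dblpow powR_gt0// exprn_even_gt0.
have inc (a b : R) : 0 <= a -> a < b -> dblpow a al * a < dblpow b al * b.
  move=> a0 ab; have b0 : 0 < b by exact: le_lt_trans ab.
  apply: (@le_lt_trans _ _ (dblpow b al * a)).
    by apply: ler_wpM2r => //; apply: dblpow_le => //; rewrite ger0_norm// ltW.
  by rewrite ltr_pM2l// pos// gt_eqF.
have dN (z : R) : dblpow (- z) al = dblpow z al by rewrite /dblpow sqrrN.
have [x0|x0] := leP 0 x; first exact: inc.
have [y0|y0] := leP 0 y.
  apply: (@lt_le_trans _ _ 0); last by rewrite mulr_ge0// dblpow_ge0.
  by rewrite pmulr_rlt0// pos// lt_eqF.
have := inc (- y) (- x); rewrite !dN !mulrN !ltrN2 => -> //.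
by rewrite oppr_ge0 ltW.
Qed.

Lemma dblpow_primitive_le {R : realType} (al x y : R) : 1 <= al -> x <= y ->
  dblpow_primitive al x <= dblpow_primitive al y.
Proof.
by move=> al1; rewrite le_eqVlt => /predU1P[->//|xy]; rewrite ltW// dblpow_primitive_lt.
Qed.

Lemma arcA_inverse {R : realType} (al M x0 w : R) : 1 <= al -> 0 < M ->
  w ^+ 2 * dblpow M al < 1 ->
  exists h, cancel (arcA al M x0 w) h /\ cancel h (arcA al M x0 w).
Proof.
move=> al1 M0 wM; have [k k0 hk] := arcA_bilipschitz_ex al M x0 w al1 M0 wM.
by have [h [h1 h2 _]] := bilipschitz_inverse _ _ _ ltr01 hk; exists h.
Qed.

Lemma arcA_norm_le {R : realType} (al M x0 w k X : R) : 1 <= al -> 0 < M ->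
  w ^+ 2 * dblpow M al < 1 -> bilipschitz 1 k (arcA al M x0 w) ->
  `|arcA al M x0 w X| <= k * `|X - x0|.
Proof.
move=> al1 M0 wM Ak; have A0 := arcA0 al M x0 w al1 M0 wM.
rewrite -[in leLHS](subr0 (arcA al M x0 w X)) -A0.
have [xX|/ltW xX] := leP x0 X.
  have /andP[h1 h2] := Ak _ _ xX.
  rewrite (ger0_norm (_ : 0 <= X - x0)) ?subr_ge0// ger0_norm//.
  by apply: le_trans h1; rewrite mul1r subr_ge0.
have /andP[h1 h2] := Ak _ _ xX.
rewrite (distrC X) (distrC (arcA _ _ _ _ _)).
rewrite (ger0_norm (_ : 0 <= x0 - X)) ?subr_ge0// ger0_norm//.
by apply: le_trans h1; rewrite mul1r subr_ge0.
Qed.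


(** The height is bounded by the calibrations [y / k] and [- y / k], with [k = (|q.1| + 1)^al]: as
    [r <= 1], curves of length less than [r] stay where [|x|^al <= k]. *)
Lemma sr_ball_box {R : realType} (al r : R) (q z : R * R) : 1 <= al -> 0 < r <= 1 ->
  sr_ball al q r z ->
  `|z.1 - q.1| <= r /\ `|z.2 - q.2| <= (`|q.1| + 1) `^ al * r.
Proof.
move=> al1 /andP[r0 r1] /ereal_inf_lt[_ [T [g [T0 hg g0 gT ->]]] lr].
have al0 : 0 <= al by exact: le_trans al1.
have xr t : 0 <= t <= T -> `|(g t).1 - q.1| <= r.
  rewrite le_eqVlt => /andP[/predU1P[<- _|t0 tT]]; first by rewrite g0 subrr normr0 ltW.
  have tT' : 0 < t <= T by rewrite t0.
  rewrite -lee_fin -g0; apply: le_trans (ltW lr).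
  exact: horizontal_fst_le.
split; first by rewrite -gT; apply: xr; rewrite lexx ltW.
set k := _ `^ al; have k0 : 0 < k by rewrite powR_gt0// ltr_wpDl.
have L0 (x y : R) : `|(cst 0 : R -> R) x - (cst 0 : R -> R) y| <= 0 * `|x - y|.
  by rewrite subrr normr0 mul0r.
have d0 (x : R) : is_derive x 1 (cst 0 : R -> R) (cst 0 x) by exact: is_derive_cst.
have TT : 0 < T <= T by rewrite T0 lexx.
have key (e : R) : e ^+ 2 = 1 -> e / k * (z.2 - q.2) <= r.
  move=> e2; rewrite -lee_fin; apply: le_trans (ltW lr).
  have := calibration_le al T T (e / k) 0 g (cst 0) (cst 0) TT hg d0 L0.
  rewrite /= !addr0 -mulrBr g0 gT; apply => t tT.
  rewrite expr0n/= add0r exprMn exprMn e2 mul1r exprVn mulrC.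
  rewrite ler_pdivrMr ?exprn_gt0// mul1r lerXn2r// ?nnegrE ?powR_ge0//.
  apply: ge0_ler_powR; rewrite ?nnegrE ?addr_ge0//.
  have := xr t tT; have := ler_normD ((g t).1 - q.1) q.1; rewrite subrK; lra.
have := key 1 (expr1n _ _); have e1 : (- 1) ^+ 2 = 1 :> R by rewrite sqrrN expr1n.
have := key (- 1) e1; rewrite mulNr mul1r mulNr => k1 k2.
by rewrite ler_norml lerNl; apply/andP; split; rewrite -ler_pdivrMl// mulrN.
Qed.

Lemma leb2_box {R : realType} (a b c d : R) : 0 <= b -> 0 <= d ->
  leb2 [set z : R * R | `|z.1 - a| <= b /\ `|z.2 - c| <= d] = ((2 * b) * (2 * d))%:E.
Proof.
move=> b0 d0.
have -> : [set z : R * R | `|z.1 - a| <= b /\ `|z.2 - c| <= d] =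
   `[a - b, a + b]%classic `*` `[c - d, c + d]%classic.
  by apply/seteqP; split => -[x y] /=; rewrite !in_itv/= !ler_distl.
rewrite /leb2 measurable_mu_extE; last by apply: measurableX; exact: measurable_itv.
rewrite /= product_measure1E; [|exact: measurable_itv|exact: measurable_itv].
rewrite /= !lebesgue_measure_itv/= !lte_fin.
have side (u v : R) : 0 <= v -> (if (u - v < u + v)%R then (u + v)%:E - (u - v)%:E else 0)%E = (2 * v)%:E.
  move=> v0; rewrite -EFinB; case: ifPn => [_|]; first by congr EFin; ring.
  by rewrite -leNgt => h; congr EFin; lra.
by rewrite !side.
Qed.

(** With [P = M^(2 al)], small widths bring [1 / n] below any [k > 1] on the strip. Dividing by
    [P + 1] covers [P = 0]. *)
Lemma width_exists {R : realType} (k P : R) : 1 < k -> 0 <= P ->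
  exists2 om, 0 < om & k ^- 2 <= 1 - om ^+ 2 * P.
Proof.
move=> k1 P0; have k2 : k ^- 2 < 1 by rewrite invf_lt1 ?exprn_gt0 ?exprn_egt1//; exact: lt_trans k1.
set e := k ^- 2 in k2 *.
have h : 0 < (1 - e) / (P + 1) by apply: divr_gt0; lra.
exists (Num.sqrt ((1 - e) / (P + 1))); first by rewrite sqrtr_gt0.
rewrite sqr_sqrtr ?(ltW h)// mulrAC lerBrDr -lerBrDl ler_pdivrMr; last lra.
by rewrite ler_wpM2l//; lra.
Qed.

(** Endpoints of short arcs issued from the centre fill the image of a box under the height map. The
    box has abscissas in [[c + rho / 2, c + rho]], away from [c], where the slope of the height in
    the width degenerates. *)
Lemma sr_ball_leb2_gt0 {R : realType} (al r : R) (q : R * R) : 1 <= al -> 0 < r ->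
  (0 < leb2 (sr_ball al q r))%E.
Proof.
case: q => c b al1 r0; pose rho := Num.min r 1 / 4.
have [rho0 rho1 rhor] : [/\ 0 < rho, rho <= 1 / 4 & 2 * rho < r].
  rewrite /rho; have [h|h] := leP r 1; split; lra.
pose M := `|c| + 3; have M0 : 0 < M by rewrite /M ltr_wpDl.
(* With [k = 2], an arc to an abscissa within [rho] of [c] has length at most [2 * rho < r]. *)
have [|om om0 omM] := width_exists 2 (dblpow M al) _ (dblpow_ge0 _ _); first lra.
pose z := c + 3 / 4 * rho; pose d := rho / 4.
have zX X : `|X - z| <= d -> c + rho / 2 <= X <= c + rho.
  by rewrite ler_distl /z /d => /andP[h1 h2]; apply/andP; split; lra.
have cc := ler_norm c; have cc' := ler_norm (- c); rewrite normrN in cc'.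
have [] := @height_fiber_map R al M c b om 2 z d 1
  (dblpow_primitive al (c + rho / 2) - dblpow_primitive al c)
  (dblpow_primitive al (c + rho) - dblpow_primitive al c) al1 M0 (ltW om0) _ omM.
- lra.
- rewrite /d; lra.
- by move=> X /zX /andP[h1 h2]; rewrite ler_norml /M; apply/andP; split; lra.
- rewrite /M; lra.
- by left; rewrite /z /d; split => //; lra.
- by rewrite subr_ge0 ltW// dblpow_primitive_lt//; lra.
- move=> X /zX /andP[h1 h2]; rewrite mul1r !lerD2r.
  by rewrite !dblpow_primitive_le.
move=> f [fb fc fE].
pose D := [set p : R * R | `|p.1 - z| <= d /\ `|p.2 - 0| <= om].
apply: (@lt_le_trans _ _ (leb2 ((fun p => (p.1, f p.1 p.2)) @` D))); last first.
  suff H : [set (p.1, f p.1 p.2) | p in D] `<=` sr_ball al (c, b) r by exact: le_mu_ext H.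
  move=> p [[X w] [/= Xz]]; rewrite subr0 => wom <-.
  rewrite /sr_ball/= fE// mul1r.
  have k2 : (0 < 2 :> R) by [].
  have wM : w ^+ 2 * dblpow M al < 1 := width_small al M om 2 (ltW om0) k2 omM w wom.
  have wk : 2 ^- 2 <= 1 - w ^+ 2 * dblpow M al.
    apply: le_trans omM _; rewrite lerD2l lerN2; apply: ler_wpM2r; first exact: dblpow_ge0.
    by rewrite -real_normK ?num_real// lerXn2r// nnegrE ltW.
  have Ak := arcA_bilipschitz al M c w al1 M0 wM 2 k2 wk.
  have [h [h1 h2]] := arcA_inverse al M c w al1 M0 wM.
  have /andP[X1 X2] := zX X Xz.
  have AX : `|arcA al M c w X| <= 2 * rho.
    apply: (le_trans (arcA_norm_le al M c w 2 X al1 M0 wM Ak)).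
    by rewrite ler_pM2l// ger0_norm; lra.
  rewrite (sr_dist_arc al M c b w X al1 M0 wM _ _ h h1 h2).
  - by rewrite lte_fin; apply: le_lt_trans rhor.
  - by rewrite /M; lra.
  - by rewrite /M ltr_norml; apply/andP; split; lra.
  - by rewrite /M; lra.
have lo0 : 0 < dblpow_primitive al (c + rho / 2) - dblpow_primitive al c.
  by rewrite subr_gt0 dblpow_primitive_lt//; lra.
have fm y : measurable_fun setT ((fun x => f x y) : measurableTypeR R -> measurableTypeR R).
  exact: continuous_measurable_fun.
have /andP[h _] := leb2_fiber_bilipschitz _ _ f D lo0 fb fm.
apply: lt_le_trans h; rewrite /D leb2_box ?(ltW om0)//; last by rewrite /d; lra.
rewrite -EFinM lte_fin; apply: mulr_gt0 => //.
by apply: mulr_gt0; apply: mulr_gt0 => //; rewrite /d; lra.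
Qed.

(** * The distortion coefficient *)

Lemma arcB_width0 {R : realType} (al M x0 X : R) : 1 <= al -> 0 < M -> arcB al M x0 0 X = 0.
Proof.
move=> al1 M0; have wM : 0 ^+ 2 * dblpow M al < 1 :> R by rewrite expr0n mul0r ltr01.
apply: etrans (arcB0 al M x0 0 al1 M0 wM); apply: is_derive_0_is_cst => x.
by apply: (is_derive_eq (is_derive_arcB al M x0 0 al1 M0 wM x)); rewrite !mul0r.
Qed.

(** For [0 <= e <= 1], [(1 + e)^n <= 1 + (2^n - 1) e]: each factor turns a coefficient [a] into
    [2 a + 1], which gives 63 for [n = 6]. *)
Lemma exprn_le_exists {R : realType} (K : R) : 1 < K ->
  exists2 k, 1 < k <= 2 & k ^+ 6 <= K.
Proof.
move=> K1; pose e := Num.min 1 ((K - 1) / 63).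
have [e0 e1 eK] : [/\ 0 < e, e <= 1 & 63 * e <= K - 1].
  by rewrite /e; have [h|h] := leP 1 ((K - 1) / 63); split; lra.
exists (1 + e); first by apply/andP; split; lra.
have step (a b : R) : 0 <= a -> 0 <= b -> b <= 1 + a * e -> b * (1 + e) <= 1 + (2 * a + 1) * e.
  move=> a0 b0 ba; apply: (@le_trans _ _ ((1 + a * e) * (1 + e))).
    by rewrite ler_wpM2r//; lra.
  by have : a * e * e <= a * e by [rewrite ler_piMr// mulr_ge0// ltW]; lra.
have p n : 0 <= (1 + e) ^+ n by rewrite exprn_ge0//; lra.
have p1 : (1 + e) ^+ 1 <= 1 + 1 * e by rewrite expr1 mul1r.
have p2 := step _ _ ler01 (p 1%N) p1; rewrite -exprSr in p2.
have n3 : 0 <= 2 * 1 + 1 :> R by lra.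
have p3 := step _ _ n3 (p 2%N) p2; rewrite -exprSr in p3.
have n4 : 0 <= 2 * (2 * 1 + 1) + 1 :> R by lra.
have p4 := step _ _ n4 (p 3%N) p3; rewrite -exprSr in p4.
have n5 : 0 <= 2 * (2 * (2 * 1 + 1) + 1) + 1 :> R by lra.
have p5 := step _ _ n5 (p 4%N) p4; rewrite -exprSr in p5.
have n6 : 0 <= 2 * (2 * (2 * (2 * 1 + 1) + 1) + 1) + 1 :> R by lra.
have p6 := step _ _ n6 (p 5%N) p5; rewrite -exprSr in p6.
by apply: (le_trans p6); lra.
Qed.

Lemma continuous_ratio_bounds {R : realType} (f : R -> R) (z k : R) :
  {for z, continuous f} -> 0 < f z -> 1 < k ->
  exists2 d, 0 < d & forall x, `|x - z| <= d -> f z / k <= f x <= k * f z.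
Proof.
move=> cf fz k1; have k0 : 0 < k by exact: lt_trans k1.
have v1 : k^-1 < 1 by rewrite invf_lt1.
have lo : f z / k < f z by rewrite gtr_pMr.
have hi : f z < k * f z by rewrite ltr_pMl.
pose e := Num.min (f z - f z / k) (k * f z - f z).
have e0 : 0 < e by rewrite lt_min !subr_gt0 lo.
have /cvgrPdist_lt/(_ e e0)[d /= d0 hd] := cf.
exists (d / 2); first by rewrite divr_gt0.
move=> x xd; have : `|z - x| < d by rewrite distrC; apply: le_lt_trans xd _; lra.
move=> /hd; rewrite ltr_norml => /andP[h1 h2].
have : e <= f z - f z / k by rewrite ge_min lexx.
have : e <= k * f z - f z by rewrite ge_min lexx orbT.
by move=> *; apply/andP; split; lra.
Qed.

(** One inclusion is uniqueness of the arcs, the other their minimality. Equality is required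
    because the area is estimated from both sides. *)
Lemma intermediate_arcs {R : realType} (al M x0 y0 om k s t : R) (W : set (R * R))
    (f1 ft fT : R -> R -> R) :
  1 <= al -> 0 < M -> 0 <= om -> 0 < k -> k ^- 2 <= 1 - om ^+ 2 * dblpow M al ->
  `|s| = 1 -> 0 <= t <= 1 -> `|x0| < M ->
  (forall X w, W (X, w) -> [/\ `|w| <= om, `|X| < M, X != x0, `|x0| + k * `|X - x0| <= M &
    f1 X w = y0 + arcB al M x0 (s * w) X]) ->
  (forall X w, W (X, w) ->
     arcA al M x0 (s * w) (fT X w) = t * arcA al M x0 (s * w) X) ->
  (forall X w, W (X, w) -> ft (fT X w) w = y0 + arcB al M x0 (s * w) (fT X w)) ->
  intermediate al t (x0, y0) ((fun p => (p.1, f1 p.1 p.2)) @` W) =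
  (fun p => (p.1, ft p.1 p.2)) @` ((fun p => (fT p.1 p.2, p.2)) @` W).
Proof.
move=> al1 M0 om0 k0 omM s1 t01 x0M WE fTE ftE.
have swom (w : R) : `|w| <= om -> `|s * w| <= om by rewrite normrM s1 mul1r.
have key X w : W (X, w) -> exists h, [/\ cancel (arcA al M x0 (s * w)) h,
    cancel h (arcA al M x0 (s * w)), (s * w) ^+ 2 * dblpow M al < 1,
    `|x0| + `|arcA al M x0 (s * w) X| <= M &
    arc_curve al M x0 y0 (s * w) X h t = (fT X w, ft (fT X w) w)].
  move=> Ww; have [wom XM Xx0 kM f1E] := WE X w Ww.
  have wM := width_small al M om k om0 k0 omM (s * w) (swom w wom).
  have wk : k ^- 2 <= 1 - (s * w) ^+ 2 * dblpow M al.
    apply: le_trans omM _; rewrite lerD2l lerN2; apply: ler_wpM2r; first exact: dblpow_ge0.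
    by rewrite -real_normK ?num_real// lerXn2r ?nnegrE ?swom.
  have Ak := arcA_bilipschitz al M x0 (s * w) al1 M0 wM k k0 wk.
  have [h [h1 h2]] := arcA_inverse al M x0 (s * w) al1 M0 wM.
  exists h; split => //.
    by apply: le_trans kM; rewrite lerD2l; exact: arcA_norm_le.
  by rewrite ftE// /arc_curve /arc_x -fTE// h1.
apply/seteqP; split => [z [g [gg gm g0 [[X w] Ww /= g1] ->]]|z [_ [[X w] Ww <-] <-]].
  have [h [h1 h2 wM AM cE]] := key X w Ww; have [wom XM Xx0 kM f1E] := WE X w Ww.
  exists (fT X w, w); first by exists (X, w).
  rewrite /= -cE; apply/esym.
  by apply: (arc_curve_unique al M x0 y0 (s * w) X al1 M0 wM x0M XM h h1 h2) => //; rewrite -g1 f1E.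
have [h [h1 h2 wM AM cE]] := key X w Ww; have [wom XM Xx0 kM f1E] := WE X w Ww.
exists (arc_curve al M x0 y0 (s * w) X h); split.
- exact: arc_curve_geodesic.
- exact: arc_curve_minimising.
- exact: arc_curve0.
- by exists (X, w) => //=; rewrite arc_curve1// f1E.
- by rewrite cE.
Qed.

Lemma le_leb2 {R : realType} (A B : set (R * R)) : A `<=` B -> (leb2 A <= leb2 B)%E.
Proof. by move=> AB; exact: le_mu_ext AB. Qed.

(** A map fixing [x0] with slopes close to [t] is close to the homothety of ratio [t]; the lower
    slope enters through [1 / k >= 2 - k]. This locates the abscissas of intermediate points. *)
Lemma bilipschitz_anchor {R : realType} (f : R -> R) (t k x0 X : R) :
  0 < t -> 1 <= k -> bilipschitz (t / k) (t * k) f -> f x0 = x0 ->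
  `|f X - (x0 + t * (X - x0))| <= t * (k - 1) * `|X - x0|.
Proof.
move=> t0 k1 ftk fx0; have k0 : 0 < k by exact: lt_le_trans k1.
have tk : t * (2 - k) <= t / k.
  rewrite ler_pdivlMr// -mulrA -[leRHS]mulr1 ler_pM2l//.
  by have := sqr_ge0 (k - 1); rewrite expr2; lra.
have [xX|/ltW xX] := leP x0 X.
  have := ftk _ _ xX; rewrite fx0 => /andP[h1 h2]; rewrite (ger0_norm (_ : 0 <= X - x0)) ?subr_ge0//.
  have h3 : t * (2 - k) * (X - x0) <= t / k * (X - x0) by rewrite ler_wpM2r ?subr_ge0.
  by rewrite ler_norml; apply/andP; split; lra.
have := ftk _ _ xX; rewrite fx0 => /andP[h1 h2].
rewrite (distrC X) (ger0_norm (_ : 0 <= x0 - X)) ?subr_ge0//.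
have h3 : t * (2 - k) * (x0 - X) <= t / k * (x0 - X) by rewrite ler_wpM2r ?subr_ge0.
by rewrite ler_norml; apply/andP; split; lra.
Qed.

(** A height map costs [k'^3 k <= k^4] on one side and [k] on the other, the time map costs [k]. One
    height map is applied and one is inverted, so [k^6] is lost either way. *)
Lemma volume_ratio_bounds {R : realType} (k k' t I J K b w v z : R) :
  1 < k' -> k' <= k -> k ^+ 6 <= K -> 0 < t -> 0 < I -> 0 < J -> 0 < b ->
  0 <= w -> 0 <= v ->
  I / k * w <= b -> b <= k' ^+ 3 * (k * I) * w ->
  t / k' * w <= v -> v <= t * k' * w ->
  J / k * v <= z -> z <= k' ^+ 3 * (k * J) * v ->
  t * (J / I) / K <= z / b <= t * (J / I) * K.
Proof.
move=> k'1 k'k kK t0 I0 J0 b0 w0 v0 B1 B2 T1 T2 Z1 Z2.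
have k'0 : 0 < k' by exact: lt_trans k'1.
have k0 : 0 < k by exact: lt_le_trans k'k.
have K0 : 0 < K by apply: lt_le_trans kK; rewrite exprn_gt0.
have k3 : k' ^+ 3 <= k ^+ 3 by rewrite lerXn2r// nnegrE ltW.
have r0 : 0 < t * (J / I) by rewrite mulr_gt0// divr_gt0.
have B2' : b <= k ^+ 4 * I * w.
  apply: (le_trans B2); apply: ler_wpM2r => //; rewrite (exprSr k 3) -mulrA.
  by apply: ler_wpM2r => //; rewrite mulr_ge0// ltW.
have Z2' : z <= k ^+ 4 * J * v.
  apply: (le_trans Z2); apply: ler_wpM2r => //; rewrite (exprSr k 3) -mulrA.
  by apply: ler_wpM2r => //; rewrite mulr_ge0// ltW.
have T2' : v <= t * k * w.
  by apply: (le_trans T2); apply: ler_wpM2r => //; rewrite ler_pM2l.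
have T1' : t / k * w <= v.
  apply: le_trans T1; apply: ler_wpM2r => //; rewrite ler_pM2l//.
  by rewrite lef_pV2 ?posrE.
have B1' : w <= b * k / I.
  by rewrite ler_pdivlMr// -ler_pdivrMr// -mulrA mulrC.
have B3 : b / (k ^+ 4 * I) <= w.
  by rewrite ler_pdivrMr ?mulr_gt0 ?exprn_gt0// mulrC.
apply/andP; split.
  rewrite ler_pdivlMr//.
  apply: (@le_trans _ _ (t * (J / I) / k ^+ 6 * b)).
    apply: ler_wpM2r; first exact: ltW.
    by rewrite ler_pM2l// lef_pV2 ?posrE ?exprn_gt0.
  apply: le_trans Z1.
  have -> : t * (J / I) / k ^+ 6 * b = J / k * (t / k * (b / (k ^+ 4 * I))).
    by field; rewrite !gt_eqF.
  rewrite ler_pM2l ?divr_gt0//; apply: le_trans T1'.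
  by rewrite ler_pM2l ?divr_gt0.
rewrite ler_pdivrMr//; apply: (le_trans Z2').
apply: (@le_trans _ _ (t * (J / I) * k ^+ 6 * b)); last first.
  by apply: ler_wpM2r; [exact: ltW|rewrite ler_pM2l].
have -> : t * (J / I) * k ^+ 6 * b = k ^+ 4 * J * (t * k * (b * k / I)).
  by field; rewrite gt_eqF.
rewrite ler_pM2l ?mulr_gt0 ?exprn_gt0//; apply: (le_trans T2').
by rewrite ler_pM2l ?mulr_gt0.
Qed.

Lemma ge0_le_EFin {R : realType} (x : \bar R) (r : R) :
  (0 <= x)%E -> (x <= r%:E)%E -> exists2 v, 0 <= v & x = v%:E.
Proof. by case: x => [v v0 _|//|//]; exists v. Qed.

Lemma distortion_ratio_bounds {R : realType} (al x0 y0 u0 t K : R) :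
  1 <= al -> u0 != 0 -> 0 < t <= 1 -> 1 < K ->
  let J := t * ((dblpow_primitive al (x0 + u0 * t) - dblpow_primitive al x0) /
    (dblpow_primitive al (x0 + u0) - dblpow_primitive al x0)) in
  exists2 e, 0 < e & forall r, 0 < r < e ->
   ((J / K)%:E <= leb2 (intermediate al t (x0, y0) (sr_ball al ((x0 + u0)%R, y0) r))
     / leb2 (sr_ball al ((x0 + u0)%R, y0) r) <= (J * K)%:E)%E.
Proof.
move=> al1 u00 /andP[t0 t1] K1 J; set G := dblpow_primitive al in J *.
set x1 := x0 + u0 in J *; set xt := x0 + u0 * t in J *.
(* [s] orients the widths so that heights increase with them whatever the direction of [u0]; the
   increments [dG] are then positive at [x1] and [xt]. *)
pose s : R := Num.sg u0; pose dG x := s * (G x - G x0).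
have sE : s = 1 /\ 0 < u0 \/ s = -1 /\ u0 < 0.
  rewrite /s; have [h|h|h] := ltgtP u0 0; last by rewrite h eqxx in u00.
  - by right; rewrite ltr0_sg.
  - by left; rewrite gtr0_sg.
have s1 : `|s| = 1 by case: sE => -[-> _]; rewrite ?normrN normr1.
have un0 : 0 < `|u0| by rewrite normr_gt0.
have dG_gt0 x : 0 < s * (x - x0) -> 0 < dG x.
  rewrite /dG; case: sE => -[-> _]; rewrite ?mul1r ?mulN1r.
    by rewrite !subr_gt0; exact: dblpow_primitive_lt.
  by rewrite !opprB !subr_gt0; exact: dblpow_primitive_lt.
have su : s * u0 = `|u0| by rewrite /s normrEsg.
have I1 : 0 < dG x1 by apply: dG_gt0; rewrite /x1 addrAC subrr add0r su.
have It : 0 < dG xt.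
  by apply: dG_gt0; rewrite /xt addrAC subrr add0r mulrA su mulr_gt0.
have cdG : continuous dG.
  move=> z; apply: (@cvgM _ R); first exact: cvg_cst.
  apply: cvgB; last exact: cvg_cst.
  exact: is_derive1_continuous (is_derive_dblpow_primitive al z al1).
have [k /andP[k1 k2] kK] := exprn_le_exists K K1.
have k0 : 0 < k by exact: lt_trans k1.
have [d1 d10 hd1] := continuous_ratio_bounds dG x1 k (cdG x1) I1 k1.
have [dt dt0 hdt] := continuous_ratio_bounds dG xt k (cdG xt) It k1.
(* Within [d] of [x1] and of [xt] the increments of [G] vary by a factor at most [k], and
   [d <= t |u0|] keeps both boxes on one side of [x0]. *)
pose d := Num.min (Num.min d1 dt) (Num.min 1 (t * `|u0|)).
have d0 : 0 < d by rewrite !lt_min d10 dt0 ltr01 mulr_gt0.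
have [dd1 ddt dle1 dtu] : [/\ d <= d1, d <= dt, d <= 1 & d <= t * `|u0|].
  by split; rewrite /d !ge_min lexx ?orbT.
have du : d <= `|u0| by apply: (le_trans dtu); rewrite ler_piMl.
(* A second tolerance, which must depend on [d]: the time map has slopes within a factor [k'] of [t]
   and has to land within [d] of [xt]. *)
pose k' := 1 + Num.min (k - 1) (d / (2 * (`|u0| + 1))).
have e0 : 0 < d / (2 * (`|u0| + 1)) by rewrite divr_gt0//; lra.
have k'1 : 1 < k' by rewrite /k' ltrDl lt_min subr_gt0 k1.
have k'k : k' <= k by rewrite /k' -lerBrDl ge_min lexx.
have k'd : (`|u0| + 1) * (k' - 1) <= d / 2.
  have h : k' - 1 <= d / (2 * (`|u0| + 1)) by rewrite /k' addrAC subrr add0r ge_min lexx orbT.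
  rewrite mulrC -ler_pdivlMr; last lra.
  by apply: (le_trans h); rewrite invfM mulrA.
have k'0 : 0 < k' by exact: lt_trans k'1.
(* As [k' <= 2] and [|X - x0| <= |u0| + 1], arcs reaching the box have length at most [2 (|u0| + 1)]
   and stay in the strip. *)
pose M := `|x0| + 2 * (`|u0| + 1) + 1.
have M0 : 0 < M by rewrite /M; have := normr_ge0 x0; lra.
have [om om0 omM] := width_exists k' (dblpow M al) k'1 (dblpow_ge0 _ _).
have x0M : `|x0| < M by rewrite /M; lra.
have nearM z X : `|z - x0| <= `|u0| -> `|X - z| <= d -> `|X| < M.
  move=> zx Xz; have h1 := ler_normD (X - x0) x0; rewrite subrK in h1.
  have h2 := ler_normD (X - z) (z - x0); rewrite addrA subrK in h2.
  rewrite /M; lra.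
have x1n : `|x1 - x0| <= `|u0| by rewrite /x1 addrAC subrr add0r.
have xtn : `|xt - x0| <= `|u0|.
  by rewrite /xt addrAC subrr add0r normrM (gtr0_norm t0) ler_piMr.
have side z : z = x1 \/ z = xt -> s = 1 /\ x0 <= z - d \/ s = -1 /\ z + d <= x0.
  move=> zE; case: sE => -[-> u0s]; [left|right]; split=> //.
    rewrite (gtr0_norm u0s) in du dtu.
    by case: zE => ->; rewrite /x1 /xt; clear -du dtu; lra.
  rewrite (ltr0_norm u0s) in du dtu.
  by case: zE => ->; rewrite /x1 /xt; clear -du dtu; lra.
have [f1 [b1 c1 E1]] := height_fiber_map al M x0 y0 om k' x1 d s (dG x1 / k) (k * dG x1)
  al1 M0 (ltW om0) (ltW k'1) omM (ltW d0)
  (fun X h => ltW (nearM x1 X x1n h)) (ltW x0M) (side x1 (or_introl erefl))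
  (ltW (divr_gt0 I1 k0)) (fun X h => hd1 X (le_trans h dd1)).
have [ft [bt ct Et]] := height_fiber_map al M x0 y0 om k' xt d s (dG xt / k) (k * dG xt)
  al1 M0 (ltW om0) (ltW k'1) omM (ltW d0)
  (fun X h => ltW (nearM xt X xtn h)) (ltW x0M) (side xt (or_intror erefl))
  (ltW (divr_gt0 It k0)) (fun X h => hdt X (le_trans h ddt)).
have [fT [bT cT ET]] := time_fiber_map al M x0 om k' s t al1 M0 (ltW om0) k'0 omM s1 t0.
pose C := (`|x1| + 1) `^ al.
have C0 : 0 < C by rewrite powR_gt0// ltr_wpDl.
have m0 : 0 < dG x1 / k by exact: divr_gt0.
(* [r < d / 2] bounds the abscissas in the ball. Its heights differ from [y0] by at most [C r], and
   [f1] has slopes at least [dG x1 / k], so the last bound keeps the widths below [om]. *)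
exists (Num.min (Num.min 1 (d / 2)) (om * (dG x1 / k) / C)).
  by rewrite !lt_min ltr01 divr_gt0// divr_gt0// mulr_gt0.
move=> r /andP[r0]; rewrite !lt_min => /andP[/andP[r1 rd] rom].
set Ball := sr_ball al _ r.
have ballP z : Ball z -> `|z.1 - x1| <= r /\ `|z.2 - y0| <= C * r.
  by move=> Bz; apply: (sr_ball_box al r (x1, y0) z al1 _ Bz); rewrite r0 ltW.
pose W := [set p : R * R | [/\ `|p.1 - x1| <= d / 2, `|p.2| <= om & Ball (p.1, f1 p.1 p.2)]].
have d2d : d / 2 <= d by clear -d0; lra.
have om00 : `|0 : R| <= om by rewrite normr0 ltW.
have f10 X : `|X - x1| <= d -> f1 X 0 = y0.
  by move=> Xd; rewrite E1// mulr0 arcB_width0// addr0.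
(* Fibers of [f1] are onto the line, so every point of the ball has a width; it is compared with the
   width 0, whose height is [y0]. *)
have BallE : Ball = (fun p => (p.1, f1 p.1 p.2)) @` W.
  apply/seteqP; split => [[X Y] Bz|z [[X w] [/= _ _ Bz] <-]//].
  have [/= h1 h2] := ballP _ Bz.
  have [g [_ gK _]] := bilipschitz_inverse _ _ _ m0 (b1 X).
  have Xd : `|X - x1| <= d / 2 by apply: (le_trans h1); exact: ltW.
  exists (X, g Y); rewrite /= ?gK//; split => //=; last by rewrite gK.
  have := bilipschitz_ge _ _ _ (g Y) 0 (ltW m0) (b1 X).
  rewrite gK f10 ?(le_trans Xd)// subr0 mulrC => h3.
  rewrite -(ler_pM2r m0); apply: (le_trans h3); apply: (le_trans h2).
  by rewrite mulrC -ler_pdivlMr// ltW.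
have fTx0 w : `|w| <= om -> fT x0 w = x0.
  move=> wom; have swom : `|s * w| <= om by rewrite normrM s1 mul1r.
  have wM := width_small al M om k' (ltW om0) k'0 omM (s * w) swom.
  have [h [hK _]] := arcA_inverse al M x0 (s * w) al1 M0 wM.
  by apply: (can_inj hK); rewrite ET// arcA0// mulr0.
have fTd X w : `|X - x1| <= d / 2 -> `|w| <= om -> `|fT X w - xt| <= d.
  move=> Xd wom; have h := bilipschitz_anchor _ t k' x0 X t0 (ltW k'1) (bT w) (fTx0 w wom).
  have e1 : fT X w - xt = (fT X w - (x0 + t * (X - x0))) + t * (X - x1) by rewrite /xt /x1; ring.
  have e2 : `|t * (X - x1)| <= d / 2.
    rewrite normrM (gtr0_norm t0); apply: le_trans Xd.
    by rewrite ler_piMl.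
  have e3 : `|X - x0| <= `|u0| + 1.
    have h' := ler_normD (X - x1) (x1 - x0); rewrite addrA subrK in h'.
    by clear -h' Xd dle1 x1n; lra.
  have e4 : t * (k' - 1) * `|X - x0| <= d / 2.
    apply: le_trans k'd; rewrite [leRHS]mulrC; apply: ler_pM => //.
      by rewrite mulr_ge0 ?(ltW t0)// subr_ge0 ltW.
    by rewrite ler_piMl// subr_ge0 ltW.
  rewrite e1; have := ler_normD (fT X w - (x0 + t * (X - x0))) (t * (X - x1)).
  by clear -h e2 e4; lra.
have ZE : intermediate al t (x0, y0) Ball =
    (fun p => (p.1, ft p.1 p.2)) @` ((fun p => (fT p.1 p.2, p.2)) @` W).
  rewrite BallE; apply: (intermediate_arcs al M x0 y0 om k' s t W f1 ft fT) => //.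
  - exact: ltW.
  - by rewrite ltW.
  - move=> X w [/= Xd wom _]; have Xd' := le_trans Xd d2d; split => //.
    + exact: nearM Xd'.
    + apply/eqP => XE; rewrite XE /x1 opprD addrA subrr sub0r normrN in Xd.
      by move: (le_trans du Xd); clear -d0; lra.
    + have h := ler_normD (X - x1) (x1 - x0); rewrite addrA subrK in h.
      have : k' * `|X - x0| <= 2 * (`|u0| + 1).
        by apply: ler_pM => //; [exact: ltW|exact: le_trans k2|clear -h Xd dle1 x1n; lra].
      by rewrite /M; clear; lra.
    + exact: E1.
  - by move=> X w [/= Xd wom _]; exact: ET.
  - by move=> X w [/= Xd wom _]; rewrite Et// fTd.
have mf (f : R -> R) : continuous f ->
    measurable_fun setT (f : measurableTypeR R -> measurableTypeR R).
  exact: continuous_measurable_fun.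
have /andP[B1 B2] := leb2_fiber_bilipschitz _ _ f1 W m0 b1 (fun w => mf _ (c1 w)).
have mT0 : 0 < t / k' by exact: divr_gt0.
have /andP[T1 T2] := leb2_fiber_bilipschitz_fst _ _ fT W mT0 bT (fun X => mf _ (cT X)).
have mt0 : 0 < dG xt / k by exact: divr_gt0.
have /andP[Z1 Z2] := leb2_fiber_bilipschitz _ _ ft ((fun p => (fT p.1 p.2, p.2)) @` W)
  mt0 bt (fun w => mf _ (ct w)).
rewrite -BallE in B1 B2; rewrite -ZE in Z1 Z2.
have ge0 (D : set (R * R)) : (0 <= leb2 D)%E by exact: mu_ext_ge0.
have Bb : (leb2 Ball <= (2 * r * (2 * (C * r)))%:E)%E.
  have Cr : 0 <= C * r by rewrite mulr_ge0// ltW.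
  rewrite -(leb2_box x1 r y0 (C * r) (ltW r0) Cr).
  have sub : Ball `<=` [set z : R * R | `|z.1 - x1| <= r /\ `|z.2 - y0| <= C * r].
    by move=> z /ballP.
  exact: le_leb2 sub.
(* Finiteness passes from the ball to [W] and on to the intermediate points, which reduces the claim
   to real quotients. *)
have [b b0 bE] := ge0_le_EFin _ _ (ge0 _) Bb.
have bpos : 0 < b by rewrite -lte_fin -bE; exact: sr_ball_leb2_gt0.
rewrite bE in B1 B2 *.
have [wv w0 wE] : exists2 v, 0 <= v & leb2 W = v%:E.
  apply: (ge0_le_EFin _ (b / (dG x1 / k)) (ge0 _)).
  by rewrite mulrC EFinM lee_pdivlMl.
rewrite wE -?EFinM ?lee_fin in B1 B2 T1 T2.
have [tv tv0 tE] := ge0_le_EFin _ _ (ge0 _) T2.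
rewrite tE -?EFinM ?lee_fin in T1 T2 Z1 Z2.
have [zv zv0 zE] := ge0_le_EFin _ _ (ge0 _) Z2.
rewrite zE -?EFinM ?lee_fin in Z1 Z2 *.
rewrite inver gt_eqF// -EFinM !lee_fin.
have -> : J = t * (dG xt / dG x1).
  rewrite /J /dG; have s0 : s != 0 by rewrite -normr_eq0 s1 oner_eq0.
  by rewrite -mulf_div mulfV// mul1r.
exact: (volume_ratio_bounds k k' t (dG x1) (dG xt) K b wv tv zv).
Qed.

(** The interval []0, e[] is one competitor for the infimum over neighbourhoods, which bounds it
    above; every neighbourhood contains some [r < e], which bounds it below. *)
Lemma limf_esup_squeeze {R : realType} (f : R -> \bar R) (J : R) : 0 <= J ->
  (forall K, 1 < K -> exists2 e, 0 < e &
     forall r, 0 < r < e -> ((J / K)%:E <= f r <= (J * K)%:E)%E) ->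
  limf_esup f (0 : R)^'+ = J%:E.
Proof.
move=> J0 hf.
have small (eps : R) : 0 < eps -> exists2 K, 1 < K & J - eps <= J / K /\ J * K <= J + eps.
  (* [J + 1] instead of [J], because [J = 0] occurs at [t = 0]. *)
  move=> e0; pose d := eps / (J + 1); have d0 : 0 < d by rewrite divr_gt0//; lra.
  have Jd : J * d <= eps.
    by rewrite /d mulrCA ler_piMr ?(ltW e0)// ler_pdivrMr; lra.
  exists (1 + d); first by rewrite ltrDl.
  have K0 : 0 < 1 + d by lra.
  split; last by lra.
  rewrite ler_pdivlMr//; have := mulr_ge0 (ltW e0) (ltW d0); lra.
apply/eqP; rewrite eq_le; apply/andP; split.
  apply/lee_addgt0Pr => eps e0; have [K K1 [_ hK]] := small eps e0.
  have [e ep he] := hf K K1.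
  apply: (@le_trans _ _ (ereal_sup (f @` `]0, e[))).
    apply: ereal_inf_lbound; exists `]0, e[%classic => //.
    near=> r; rewrite /= in_itv/=; apply/andP; split; near: r.
      exact: nbhs_right_gt.
    exact: nbhs_right_lt.
  apply: ge_ereal_sup => _ [r /= + <-]; rewrite in_itv/= => /he/andP[_].
  by move=> /le_trans; apply; rewrite -EFinD lee_fin.
apply: le_ereal_inf_tmp => _ [V V0 <-].
apply/lee_subgt0Pr => eps e0; have [K K1 [hK _]] := small eps e0.
have [e ep he] := hf K K1.
have [r [Vr re]] : exists r, V r /\ 0 < r < e.
  near (0 : R)^'+ => r; exists r; split; first by near: r.
  apply/andP; split; near: r; [exact: nbhs_right_gt|exact: nbhs_right_lt].
apply: (@le_trans _ _ (f r)); last by apply: ereal_sup_ubound; exists r.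
have /andP[h _] := he r re; apply: le_trans h.
by rewrite -EFinB lee_fin.
Unshelve. all: by end_near. Qed.

(** [v] is conserved, and [v = 0] makes [u] and [y] constant; this locates the endpoint from the
    initial covector. *)
Lemma extremal_horizontal_line {R : realType} (al u0 : R) (g l : R -> R * R) :
  normal_extremal al `[0, 1] g l -> l 0 = (u0, 0) ->
  g 1 = ((g 0).1 + u0, (g 0).2).
Proof.
move=> ext l0.
have [cx dx] := is_derive_in_clamp (fun s => (g s).1) (fun t => (l t).1)
   (fun t ht => let: And4 e _ _ _ := ext t ht in e).
have [cy dy] := is_derive_in_clamp (fun s => (g s).2) (fun t => (l t).2 * dblpow (g t).1 al)
   (fun t ht => let: And4 _ e _ _ := ext t ht in e).
have [cu du] := is_derive_in_clamp (fun s => (l s).1)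
   (fun t => - (al * (l t).2 ^+ 2 * dblpow (g t).1 (al - 1) * (g t).1))
   (fun t ht => let: And4 _ _ e _ := ext t ht in e).
have [cv dv] := is_derive_in_clamp (fun s => (l s).2) (fun t => 0)
   (fun t ht => let: And4 _ _ _ e := ext t ht in e).
have W (t : R) : 0 < t < 1 -> 0 <= t <= 1 by case/andP=> *; rewrite !ltW.
have c01 (t : R) : 0 <= t <= 1 -> clamp 0 1 t = t := clamp_id 0 1 t.
have h0 : (0 : R) <= 0 <= (1 : R) by rewrite lexx ler01.
have h1 : (0 : R) <= 1 <= (1 : R) by rewrite lexx ler01.
have v0 t : 0 <= t <= 1 -> (l t).2 = 0.
  by move=> t01; have /= := derive0_cst _ 0 1 cv dv t t01; rewrite !c01// l0.
have u0E t : 0 <= t <= 1 -> (l t).1 = u0.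
  move=> t01; have /= := derive0_cst _ 0 1 cu _ t t01; rewrite !c01// l0; apply => z z01.
  by apply: (is_derive_eq (du z z01)); rewrite v0 ?W// expr0n/= mulr0 !mul0r oppr0.
rewrite [LHS]surjective_pairing; congr (_, _).
  suff <- : (g 1).1 - u0 = (g 0).1 by rewrite subrK.
  have /= := derive0_cst (fun t : R => (g (clamp 0 1 t)).1 - u0 * t) 0 1 _ _ 1 h1.
  rewrite !c01// mulr1 mulr0 subr0; apply.
    move=> z; apply: cvgB; first exact: cx.
    by apply: (@cvgM _ R); [exact: cvg_cst|exact: cvg_id].
  move=> z z01; have d := is_deriveB (dx z z01) (is_deriveZ u0 (is_derive_id z (1 : R))).
  by apply: (is_derive_eq d); rewrite u0E ?W// /GRing.scale/= mulr1 subrr.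
have /= := derive0_cst _ 0 1 cy _ 1 h1; rewrite !c01//; apply => z z01.
by apply: (is_derive_eq (dy z z01)); rewrite v0 ?W// mul0r.
Qed.

Theorem proposition2 (R : realType) (alpha : R) (halpha : 1 <= alpha)
    (x0 y0 : R) (q : R * R) (hneq : (x0, y0) <> q)
    (hcut : ~ Cut alpha (x0, y0) q)
    (u0 v0 : R) (gamma lambda : R -> R * R)
    (hext : normal_extremal alpha `[0, 1] gamma lambda)
    (hmin : minimising alpha 1 gamma)
    (hstart : gamma 0 = (x0, y0)) (hend : gamma 1 = q)
    (hcov : lambda 0 = (u0, v0))
    (hv0 : v0 = 0) :
  forall t : R, 0 <= t <= 1 ->
    distortion alpha t (x0, y0) q =
    (t * ((dblpow (u0 * t + x0) alpha * (u0 * t + x0) - dblpow x0 alpha * x0)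
          / (dblpow (u0 + x0) alpha * (u0 + x0) - dblpow x0 alpha * x0)))%:E.
Proof.
move=> t /andP[t0 t1]; rewrite hv0 in hcov.
have qE : q = (x0 + u0, y0).
  by rewrite -hend (extremal_horizontal_line alpha u0 gamma lambda hext hcov) hstart.
have u00 : u0 != 0.
  by apply/eqP => u00; apply: hneq; rewrite qE u00 addr0.
rewrite qE /distortion.
set den := dblpow (u0 + x0) alpha * (u0 + x0) - dblpow x0 alpha * x0.
have JE : t * ((dblpow (u0 * t + x0) alpha * (u0 * t + x0) - dblpow x0 alpha * x0) / den) =
  t * ((dblpow_primitive alpha (x0 + u0 * t) - dblpow_primitive alpha x0) /
    (dblpow_primitive alpha (x0 + u0) - dblpow_primitive alpha x0)).
  have al1 : 2 * alpha + 1 != 0 by rewrite gt_eqF//; lra.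
  by rewrite /dblpow_primitive -!mulrBl -mulf_div divff ?invr_eq0// mulr1 /den !(addrC x0).
(* At [t = 0] the time map would have no positive lower slope; the intermediate points lie in the
   singleton of the starting point, which is null. *)
have [t00|tn0] := eqVneq t 0.
  rewrite t00 mul0r; apply: limf_esup_squeeze => // K K1; exists 1 => // r /andP[r0 _].
  set Z := intermediate _ _ _ _.
  have Z0 : Z `<=` [set z : R * R | `|z.1 - x0| <= 0 /\ `|z.2 - y0| <= 0].
    by move=> z [g [_ _ g0 _ ->]]; rewrite g0 /= !subrr normr0.
  have {}Z0 : leb2 Z = 0%E.
    apply/eqP; rewrite eq_le [X in _ && X]mu_ext_ge0// andbT.
    by apply: (le_trans (le_leb2 _ _ Z0)); rewrite leb2_box// mulr0 mul0r.
  by rewrite Z0 mul0e !mul0r lexx.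
have tpos : 0 < t by rewrite lt_neqAle eq_sym tn0.
have tt : 0 < t <= 1 by rewrite tpos.
rewrite JE; apply: limf_esup_squeeze => [|K K1]; last exact: distortion_ratio_bounds.
(* Both increments have the sign of [u0], so their quotient is nonnegative in either direction. *)
apply: mulr_ge0 => //; have [u0n|u0p|u00'] := ltgtP u0 0; last by rewrite u00' eqxx in u00.
  rewrite -mulrNN -invrN !opprB; apply: divr_ge0; rewrite subr_ge0 dblpow_primitive_le//.
    by rewrite gerDl nmulr_rle0.
  by rewrite gerDl ltW.
apply: divr_ge0; rewrite subr_ge0 dblpow_primitive_le//.
  by rewrite lerDl pmulr_rge0.
by rewrite lerDl ltW.
Qed.
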